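(* Let $N \ge 2$ and $m \ge 1$ be integers. Then there exist infinitely many distinct pairs of real quadratic fields $$\left(\mathbb{Q}(\sqrt{D}),\ \mathbb{Q}(\sqrt{D+m})\right), \qquad D \in \mathbb{Z},\ D > 0,$$ such that the class numbers of both fields are divisible by $N$. Moreover, writing $N = 2^{e}n$ with $e \ge 0$ and $n$ odd, if $n > 1$, then (for these infinitely many pairs) the class group of each of the two fields contains an element of order $n$. In particular, if $N$ is odd, then the class group of each field contains an element of order $N$.
   Context: The class group of a number field means its ordinary (wide) ideal class group, and the class number is the order of that group. That $\mathbb{Q}(\sqrt{D})$ and $\mathbb{Q}(\sqrt{D+m})$ are real quadratic fields means in particular that neither $D$ nor $D+m$ is a perfect square. ''Infinitely many distinct pairs'' refers to distinctness as pairs of fields, not merely distinct values of $D$. *)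

(* Defs.v *)
From mathcomp Require Import all_boot all_order all_algebra all_field.
From mathcomp Require Import boolp classical_sets functions cardinality.

Set Implicit Arguments.
Unset Strict Implicit.
Unset Printing Implicit Defensive.

Import Order.TTheory GRing.Theory Num.Theory.

Local Open Scope classical_set_scope.
Local Open Scope ring_scope.

(* Number fields are represented as subfields of algC, given by their carrier
   sets, so that equality of fields is equality of subsets of algC.  Two
   quadratic subfields of algC are isomorphic only if they are equal. *)

Definition perfect_square (d : int) : Prop := exists k : int, d = k ^+ 2.

Definition Qsqrt (d : int) : set algC :=
  [set x | exists a b : rat, x = ratr a + ratr b * sqrtC d%:~R].

Section ClassGroup.

Variable K : set algC.

Definition ring_of_integers : set algC := [set x | K x /\ x \in Aint].

Definition fractional_ideal (I : set algC) : Prop :=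
  [/\ I `<=` K,
      exists2 x, I x & x != 0,
      forall x y, I x -> I y -> I (x - y),
      forall a x, ring_of_integers a -> I x -> I (a * x)
    & exists d, [/\ ring_of_integers d, d != 0
                  & forall x, I x -> ring_of_integers (d * x)]].

Definition ideal_mul (I J : set algC) : set algC :=
  [set x | exists2 s : seq (algC * algC),
     forall p, p \in s -> I p.1 /\ J p.2 & x = \sum_(p <- s) p.1 * p.2].

(* The multiplier may be any nonzero element of K, of either sign: these are
   the wide ideal classes. *)
Definition ideal_equiv (I J : set algC) : Prop :=
  exists x, [/\ K x, x != 0 & J = [set x * y | y in I]].

Definition ideal_class (I : set algC) : set (set algC) :=
  [set J | fractional_ideal J /\ ideal_equiv I J].

Definition class_group : set (set (set algC)) :=
  [set ideal_class I | I in fractional_ideal].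

(* The product of the classes of I and J is the class of I * J; see class_mulE. *)
Definition class_mul (A B : set (set algC)) : set (set algC) :=
  [set L | exists I J, [/\ A I, B J & ideal_class (ideal_mul I J) L]].

Definition class_one : set (set algC) := ideal_class ring_of_integers.

Definition class_exp (A : set (set algC)) (k : nat) : set (set algC) :=
  iter k (class_mul A) class_one.

Definition class_has_order (A : set (set algC)) (n : nat) : Prop :=
  [/\ (0 < n)%N, class_exp A n = class_one
    & forall k, (0 < k < n)%N -> class_exp A k <> class_one].

Definition class_group_has_element_of_order (n : nat) : Prop :=
  exists2 A, class_group A & class_has_order A n.

Definition class_number_is (h : nat) : Prop := (class_group #= `I_h)%card.

Definition class_number_divisible_by (N : nat) : Prop :=
  exists2 h, class_number_is h & (N %| h)%N.

End ClassGroup.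

Lemma ideal_mulZ (x y : algC) (I J : set algC) :
  ideal_mul [set x * z | z in I] [set y * z | z in J] =
  [set (x * y) * z | z in ideal_mul I J].
Proof.
apply/seteqP; split=> [w [s sP ->]|w [z [s sP Ez] <-]].

  elim: s sP => [|[a b] s IHs] sP.
    exists 0; last by rewrite big_nil mulr0.
    by exists [::] => //; rewrite big_nil.
  have [u [t tP Eu] Ew] : [set x * y * z | z in ideal_mul I J]
      (\sum_(p <- s) p.1 * p.2).
    by apply: IHs => p ps; apply: sP; rewrite inE ps orbT.
  have /= [[a' Ia' <-] [b' Jb' <-]] := sP (a, b) (mem_head _ _).
  exists (a' * b' + u); last by rewrite big_cons mulrDr Ew mulrACA.
  exists ((a', b') :: t); last by rewrite big_cons Eu.
  by move=> p; rewrite inE => /predU1P[-> //|]; apply: tP.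
rewrite Ez; exists [seq (x * p.1, y * p.2) | p <- s].
  move=> _ /mapP[p ps ->] /=; have [Ip Jp] := sP p ps.
  by split; [exists p.1 | exists p.2].
by rewrite big_map mulr_sumr; apply: eq_bigr => p _ /=; rewrite mulrACA.
Qed.

Lemma class_mulE (K I J : set algC) :
  K 1 -> (forall x y, K x -> K y -> K (x * y)) ->
  fractional_ideal K I -> fractional_ideal K J ->
  class_mul K (ideal_class K I) (ideal_class K J) =
  ideal_class K (ideal_mul I J).
Proof.
move=> K1 KM fI fJ.
have refl A : fractional_ideal K A -> ideal_class K A A.
  move=> fA; split=> //; exists 1; split; rewrite ?oner_neq0 //.
  apply/seteqP; split=> [a Aa|_ [a Aa <-]]; last by rewrite mul1r.
  by exists a; rewrite ?mul1r.
apply/seteqP; split=> [L [I' [J' [cI cJ [fL cL]]]]|L cL]; last first.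
  by exists I, J; split=> //; exact: refl.
have [_ [x [Kx x0 EI]]] := cI; have [_ [y [Ky y0 EJ]]] := cJ.
have [z [Kz z0 EL]] := cL.
split=> //; exists (z * (x * y)); split; rewrite ?mulf_neq0 //; do ?exact: KM.
  by apply: (KM) => //; apply: KM.
rewrite EL EI EJ ideal_mulZ image_comp /=.
by congr image; apply/funext => t /=; rewrite mulrA.
Qed.

(* Main.v *)
Require Import Defs.
From mathcomp Require Import all_boot all_order all_algebra all_field.
From mathcomp Require Import boolp classical_sets functions cardinality.
From mathcomp Require Import cyclic.
From mathcomp Require Import ring lra zify.

Set Implicit Arguments.
Unset Strict Implicit.
Unset Printing Implicit Defensive.

Import Order.TTheory GRing.Theory Num.Theory.

Local Open Scope classical_set_scope.
Local Open Scope ring_scope.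

(** The heart of the matter is to find, for all [N] >= 2 and [m] >= 1, a single
[D] such that the class groups of Q(sqrt D) and Q(sqrt (D + m)) both have an
element of order [N] ([certificates_exist], [certificate_class_group]).
Infinitely many pairs then come for free.  Class numbers are finite, so if the
pairs that work for [N] were finitely many, the class numbers of their first
members would be at most some [H]; but a pair obtained for [N * H.+1] also
works for [N], and its class numbers are multiples of [N * H.+1].

An element of order [N].  Let x^2 - D y^2 = z^N with 2x prime to z, and let
alpha = x + y sqrt D.  The ideal a = (z, alpha) satisfies a^N = (alpha)
([gen2_pow]).  If a^j is principal for some 0 < j < N, then alpha^j is a unit
times an N-th power, hence alpha = w gamma^p for a prime p dividing N and a
unit w ([power_class_descent]).  The units are the +-e^i; so as soon as some
unit eps is known such that neither eps nor -eps is a p-th power, w may be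
replaced by +-eps^i ([unit_mod_powers]).  The relation alpha = +-eps^i beta^p
is then refuted by sending sqrt D to a square root of D in a prime field, for
two choices of this field.  In the first one -1 is a square, alpha becomes an
element gamma that is no p-th power, and eps becomes -gamma^2: this refutes p =
2, and also p odd with p | i.  In the second one alpha becomes -1 while eps is
no p-th power for p odd: this forces p | i.

A family with enough freedom.  From here on p = r^2.  Put g = m + p, h = m - p,
W = g h, T = kappa (W + 4 p j) and D = T^2 - h/2 - j, so that D + m = T^2 + g/2
- j.  If 1 + 16 kappa^2 W j = z^N, then x = 4 kappa g T - 1 and y = 4 kappa g
satisfy x^2 - D y^2 = z^N.  For A = 8 kappa p T - 1, B = 8 kappa p and k = 16
kappa^2 p h^2 - 1 one has A^2 + k = D B^2, so that eta = A + B sqrt D has norm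
-k, and eps = eta^2 / k is a unit when k divides A.  The construction is
invariant under (m, g, h, D) -> (-m, -h, -g, D + m), with the same z and j, so
it serves both fields at once.  From the identity 2 p alpha = g eta + h one
reads that alpha = eta and k = -1 modulo the primes dividing h, whence eps =
-alpha^2, and that alpha = -1 modulo the primes dividing g: these are the two
kinds of reduction wanted.

The parameters.  Six primes l = 1 mod 8 m N are taken; modulo each of them -1
and m are squares, and r is chosen so that three of them divide h and the other
three divide g.  Everything else is adjusted with the Chinese remainder
theorem: kappa, so that 8 kappa r^3 is an N-th power s^N with s a primitive
root modulo the six primes, and is divisible by all other prime factors of g h;
then z, as an inverse of s^2 modulo k (which gives k | A) that is = 1 + 16
kappa^2 W v modulo (16 kappa^2 W)^2, so that j = N v modulo the six primes, and
A can be given any residues there. *)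

(** * Coordinates, conjugation and integers in a real quadratic field *)

Class real_quadratic (D : int) : Prop := RealQuadratic {
  radicand_gt0 : 0 < D;
  radicand_nonsquare : ~ perfect_square D
}.

Section QuadraticField.

Context (D : int) {rqD : real_quadratic D}.

Let D_gt0 : 0 < D := radicand_gt0.
Let D_nsq : ~ perfect_square D := radicand_nonsquare.

Local Notation K := (Qsqrt D).
Local Notation OK := (ring_of_integers K).

Let s : algC := sqrtC D%:~R.

Definition qel (a b : rat) : algC := ratr a + ratr b * sqrtC D%:~R.

Lemma sqr_sqrtD : s ^+ 2 = D%:~R.
Proof. exact: sqrtCK. Qed.

Lemma sqrtD_gt0 : 0 < s.
Proof. by rewrite sqrtC_gt0 ltr0z. Qed.

(** A rational root of the monic polynomial X^2 - d is an algebraic integer. *)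
Lemma rat_sqrt_int (x : rat) (d : int) : x ^+ 2 = d%:~R -> exists n : int, x = n%:~R.
Proof.
move=> xd; have : (ratr x : algC) \in Num.int.
  apply: Cint_rat_Aint (Crat_rat x) _.
  apply: (@root_monic_Aint ('X^2 - (d%:~R)%:P)).
  - by rewrite rootE !hornerE -rmorphXn /= xd rmorph_int subrr.
  - exact: monicXnsubC.
  - apply/polyOverP=> i; rewrite coefB coefXn coefC.
    by rewrite rpredB ?rpred_nat //; case: ifP => _; rewrite ?rpred_int ?rpred0.
by rewrite Cint_rat => /intrP[n ->]; exists n.
Qed.

Lemma rat_sqrD_neq (a b : rat) : a ^+ 2 = D%:~R * b ^+ 2 -> b = 0.
Proof.
move=> ab; apply/eqP; apply: contra_notT D_nsq => b0.
have [n nE] : exists n : int, a / b = n%:~R.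
  by apply: (@rat_sqrt_int _ D); rewrite expr_div_n ab mulfK // expf_neq0.
exists n; apply: (@intr_inj rat).
by rewrite rmorphXn /= -nE expr_div_n ab mulfK // expf_neq0.
Qed.

Lemma qel_eq0 a b : qel a b = 0 -> a = 0 /\ b = 0.
Proof.
move=> /eqP; rewrite addr_eq0 => /eqP ab.
have {}ab : a ^+ 2 = D%:~R * b ^+ 2.
  apply: (fmorph_inj (@ratr algC)).
  by rewrite !(rmorphXn, rmorphM) /= ab sqrrN exprMn sqrtCK ratr_int mulrC.
have b0 := rat_sqrD_neq ab; split=> //; move/eqP: ab.
by rewrite b0 expr0n mulr0 expf_eq0 => /eqP.
Qed.

Lemma qelB a b c d : qel a b - qel c d = qel (a - c) (b - d).
Proof. by rewrite /qel !rmorphB /=; ring. Qed.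

Lemma qelD a b c d : qel a b + qel c d = qel (a + c) (b + d).
Proof. by rewrite /qel !rmorphD /=; ring. Qed.

Lemma qelN a b : - qel a b = qel (- a) (- b).
Proof. by rewrite /qel !rmorphN /=; ring. Qed.

Lemma qelM a b c d :
  qel a b * qel c d = qel (a * c + D%:~R * b * d) (a * d + b * c).
Proof.
rewrite /qel !(rmorphD, rmorphM) /= ratr_int.
by rewrite -/s; ring: sqr_sqrtD.
Qed.

Lemma qel_rat a : ratr a = qel a 0.
Proof. by rewrite /qel rmorph0 mul0r addr0. Qed.

Lemma qel_int (n : int) : n%:~R = qel n%:~R 0.
Proof. by rewrite -qel_rat ratr_int. Qed.

Lemma qel0 : 0 = qel 0 0. Proof. by rewrite -qel_rat rmorph0. Qed.
Lemma qel1 : 1 = qel 1 0. Proof. by rewrite -qel_rat rmorph1. Qed.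

Lemma qel_inj a b c d : qel a b = qel c d -> a = c /\ b = d.
Proof.
move=> /eqP; rewrite -subr_eq0 qelB => /eqP /qel_eq0[/eqP ac /eqP bd].
by move: ac bd; rewrite !subr_eq0 => /eqP -> /eqP ->.
Qed.

Lemma qelP x : K x -> exists a b, x = qel a b.
Proof. by []. Qed.

Lemma K_qel a b : K (qel a b). Proof. by exists a, b. Qed.

(** The coordinates of x on the basis (1, sqrt D); the default 0 is taken
outside of the field. *)
Definition qre (x : algC) : rat := xget 0 [set a | exists b, x = qel a b].
Definition qim (x : algC) : rat := xget 0 [set b | exists a, x = qel a b].

Lemma qre_qel a b : qre (qel a b) = a.
Proof.
rewrite /qre; case: xgetP => [c _ /= [d /qel_inj[->]] //|/(_ a) /=].
by case; exists b.
Qed.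

Lemma qim_qel a b : qim (qel a b) = b.
Proof.
rewrite /qim; case: xgetP => [c _ /= [d /qel_inj[_ ->]] //|/(_ b) /=].
by case; exists a.
Qed.

Definition cj x : algC := qel (qre x) (- qim x).
Definition tr x : rat := 2 * qre x.
Definition nm x : rat := qre x ^+ 2 - D%:~R * qim x ^+ 2.

Definition qelE := (qre_qel, qim_qel).

Lemma cj_qel a b : cj (qel a b) = qel a (- b).
Proof. by rewrite /cj !qelE. Qed.
Lemma tr_qel a b : tr (qel a b) = 2 * a.
Proof. by rewrite /tr !qelE. Qed.
Lemma nm_qel a b : nm (qel a b) = a ^+ 2 - D%:~R * b ^+ 2.
Proof. by rewrite /nm !qelE. Qed.

Lemma K0 : K 0. Proof. by rewrite qel0; apply: K_qel. Qed.
Lemma K1 : K 1. Proof. by rewrite qel1; apply: K_qel. Qed.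
Lemma K_int (n : int) : K n%:~R. Proof. by rewrite qel_int; apply: K_qel. Qed.
Lemma K_rat a : K (ratr a). Proof. by rewrite qel_rat; apply: K_qel. Qed.
Lemma KB x y : K x -> K y -> K (x - y).
Proof. by move=> /qelP[a [b ->]] /qelP[c [d ->]]; rewrite qelB; apply: K_qel. Qed.
Lemma KD x y : K x -> K y -> K (x + y).
Proof. by move=> /qelP[a [b ->]] /qelP[c [d ->]]; rewrite qelD; apply: K_qel. Qed.
Lemma KN x : K x -> K (- x).
Proof. by move=> /qelP[a [b ->]]; rewrite qelN; apply: K_qel. Qed.
Lemma KM x y : K x -> K y -> K (x * y).
Proof. by move=> /qelP[a [b ->]] /qelP[c [d ->]]; rewrite qelM; apply: K_qel. Qed.
Lemma KX x n : K x -> K (x ^+ n).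
Proof.
by move=> Kx; elim: n => [|n IHn]; rewrite ?expr0 ?exprS; [exact: K1|exact: KM].
Qed.

Lemma K_cj x : K (cj x). Proof. exact: K_qel. Qed.

Lemma mulr_cj x : K x -> x * cj x = ratr (nm x).
Proof.
move=> /qelP[a [b ->]]; rewrite cj_qel nm_qel qelM qel_rat.
by congr qel; ring.
Qed.

Lemma addr_cj x : K x -> x + cj x = ratr (tr x).
Proof.
move=> /qelP[a [b ->]]; rewrite cj_qel tr_qel qelD qel_rat.
by congr qel; ring.
Qed.

Lemma cjK x : K x -> cj (cj x) = x.
Proof. by move=> /qelP[a [b ->]]; rewrite !cj_qel opprK. Qed.

Lemma cjM x y : K x -> K y -> cj (x * y) = cj x * cj y.
Proof.
move=> /qelP[a [b ->]] /qelP[c [d ->]]; rewrite qelM !cj_qel qelM.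
by congr qel; ring.
Qed.

Lemma cjD x y : K x -> K y -> cj (x + y) = cj x + cj y.
Proof.
move=> /qelP[a [b ->]] /qelP[c [d ->]]; rewrite qelD !cj_qel qelD.
by congr qel; ring.
Qed.

Lemma cjB x y : K x -> K y -> cj (x - y) = cj x - cj y.
Proof.
move=> /qelP[a [b ->]] /qelP[c [d ->]]; rewrite qelB !cj_qel qelB.
by congr qel; ring.
Qed.

Lemma cj_rat a : cj (ratr a) = ratr a.
Proof. by rewrite qel_rat cj_qel oppr0. Qed.

Lemma cj_int (n : int) : cj n%:~R = n%:~R.
Proof. by rewrite qel_int cj_qel oppr0. Qed.

Lemma cj0 : cj 0 = 0. Proof. exact: (cj_int 0). Qed.
Lemma cj1 : cj 1 = 1. Proof. exact: (cj_int 1). Qed.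

Lemma cjX x n : K x -> cj (x ^+ n) = cj x ^+ n.
Proof.
move=> Kx; elim: n => [|n IHn]; first by rewrite !expr0 cj1.
by rewrite !exprS cjM ?IHn //; exact: KX.
Qed.

Lemma nmM x y : K x -> K y -> nm (x * y) = nm x * nm y.
Proof.
by move=> /qelP[a [b ->]] /qelP[c [d ->]]; rewrite qelM !nm_qel; ring.
Qed.

Lemma nm_cj x : K x -> nm (cj x) = nm x.
Proof. by move=> /qelP[a [b ->]]; rewrite cj_qel !nm_qel sqrrN. Qed.

Lemma nm_int (n : int) : nm n%:~R = n%:~R ^+ 2.
Proof. by rewrite qel_int nm_qel; ring. Qed.

Lemma nm1 : nm 1 = 1. Proof. by rewrite (nm_int 1) expr1n. Qed.

Lemma nm_eq0 x : K x -> nm x = 0 -> x = 0.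
Proof.
move=> /qelP[a [b ->]]; rewrite nm_qel => /eqP; rewrite subr_eq0 => /eqP ab.
have b0 := rat_sqrD_neq ab; move/eqP: ab.
by rewrite b0 expr0n mulr0 expf_eq0 /= => /eqP ->; rewrite -qel0.
Qed.

Lemma KV x : K x -> K x^-1.
Proof.
move=> Kx; have [->|x0] := eqVneq x 0; first by rewrite invr0; exact: K0.
have n0 : ratr (nm x) != 0 :> algC.
  by rewrite fmorph_eq0; apply: contra_neq x0; exact: nm_eq0.
have -> : x^-1 = ratr (nm x)^-1 * cj x.
  by rewrite fmorphV /= -mulr_cj // invfM -mulrA mulVf ?mulr1 //;
     move: n0; rewrite -mulr_cj // mulf_eq0 negb_or => /andP[].
by apply: KM; [exact: K_rat|exact: K_cj].
Qed.

Lemma Kreal x : K x -> x \is Num.real.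
Proof.
move=> /qelP[a [b ->]]; rewrite /qel.
by apply: rpredD; last apply: rpredM;
   rewrite ?(gtr0_real sqrtD_gt0) ?Creal_Crat ?Crat_rat.
Qed.

(** Conjugation commutes with rational polynomials, so x and its conjugate have
the same minimal polynomial. *)
Lemma cj_Aint x : K x -> x \in Aint -> cj x \in Aint.
Proof.
move=> Kx Ax.
have [p [Dp pm] _] := minCpolyP x.
apply: (@root_monic_Aint (minCpoly x)); last by [].
  2: exact: minCpoly_monic.
have hE (q : {poly rat}) y : K y -> cj (map_poly ratr q).[y] = (map_poly ratr q).[cj y].
  move=> Ky; have KH (r : {poly rat}) : K (map_poly ratr r).[y].
    elim/poly_ind: r => [|r c IH]; first by rewrite rmorph0 horner0; exact: K0.
    rewrite rmorphD rmorphM /= map_polyX map_polyC /= hornerMXaddC.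
    by apply: KD; [exact: KM|exact: K_rat].
  elim/poly_ind: q => [|q c IH]; first by rewrite rmorph0 !horner0 cj0.
  rewrite rmorphD rmorphM /= map_polyX map_polyC /= !hornerMXaddC.
  by rewrite (cjD (KM (KH q) Ky) (K_rat c)) (cjM (KH q) Ky) IH cj_rat.
rewrite rootE Dp -hE // -Dp.
by have /eqP -> := root_minCpoly x; rewrite cj0.
Qed.

Lemma OK_K x : OK x -> K x. Proof. by case. Qed.

Lemma OK_cj x : OK x -> OK (cj x).
Proof. by move=> [Kx Ax]; split; [exact: K_cj|exact: cj_Aint]. Qed.

Lemma OKM x y : OK x -> OK y -> OK (x * y).
Proof. by move=> [? ?] [? ?]; split; [exact: KM|rewrite rpredM]. Qed.
Lemma OKD x y : OK x -> OK y -> OK (x + y).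
Proof. by move=> [? ?] [? ?]; split; [exact: KD|rewrite rpredD]. Qed.
Lemma OKB x y : OK x -> OK y -> OK (x - y).
Proof. by move=> [? ?] [? ?]; split; [exact: KB|rewrite rpredB]. Qed.
Lemma OKN x : OK x -> OK (- x).
Proof. by move=> [? ?]; split; [exact: KN|rewrite rpredN]. Qed.
Lemma OK_int (n : int) : OK n%:~R.
Proof. by split; [exact: K_int|exact: Aint_int]. Qed.
Lemma OK0 : OK 0. Proof. exact: (OK_int 0). Qed.
Lemma OK1 : OK 1. Proof. exact: (OK_int 1). Qed.
Lemma OKX x n : OK x -> OK (x ^+ n).
Proof. by move=> [? ?]; split; [exact: KX|rewrite rpredX]. Qed.

Lemma OK_trP x : OK x -> exists t : int, tr x = t%:~R.
Proof.
move=> Ox; have [Kx _] := Ox; have [_] := OKD Ox (OK_cj Ox).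
rewrite addr_cj // => At; have := Cint_rat_Aint (Crat_rat _) At.
by rewrite Cint_rat => /intrP.
Qed.

Lemma OK_nmP x : OK x -> exists n : int, nm x = n%:~R.
Proof.
move=> Ox; have [Kx _] := Ox; have [_] := OKM Ox (OK_cj Ox).
rewrite mulr_cj // => At; have := Cint_rat_Aint (Crat_rat _) At.
by rewrite Cint_rat => /intrP.
Qed.

Lemma OK_tr_nm x (t n : int) :
  K x -> tr x = t%:~R -> nm x = n%:~R -> OK x.
Proof.
move=> Kx tE nE; split=> //.
apply: (@root_monic_Aint ('X^2 - (t%:~R)%:P * 'X + (n%:~R)%:P)).
- rewrite rootE !hornerE.
  have -> : t%:~R = x + cj x :> algC by rewrite addr_cj // tE ratr_int.
  have -> : n%:~R = x * cj x :> algC by rewrite mulr_cj // nE ratr_int.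
  by apply/eqP; ring.
- rewrite -addrA monicE lead_coefDl ?lead_coefXn // size_polyXn ltnS.
  rewrite (leq_trans (size_polyD _ _)) // geq_max.
  rewrite (leq_trans (size_polyC_leq1 _)) // size_polyN andbT.
  rewrite (leq_trans (size_polyMleq _ _)) // size_polyX addn2 /=.
  by rewrite ltnS size_polyC_leq1.
apply/polyOverP=> i; rewrite coefD coefB coefXn coefCM coefX coefC.
rewrite rpredD ?rpredB ?rpredM ?rpred_nat ?rpred_int //.
by case: ifP => _; rewrite ?rpred_int ?rpred0.
Qed.

(** The trace and the norm of x = a + b sqrt D are integers; hence
(2 D b)^2 = D ((2 a)^2 - 4 nm x) is an integer, and so is 2 D b. *)
Lemma OK_coord x : OK x ->
  exists X Y : int, (2 * D)%:~R * x = qel X%:~R Y%:~R.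
Proof.
move=> Ox; have [/qelP[a [b xE]] _] := Ox.
have [t tE] := OK_trP Ox; have [n nE] := OK_nmP Ox.
have ta : 2 * a = t%:~R by rewrite -tE xE tr_qel.
have nb : a ^+ 2 - D%:~R * b ^+ 2 = n%:~R by rewrite -nE xE nm_qel.
have [c cE] : exists c : int, 2 * D%:~R * b = c%:~R.
  apply: (@rat_sqrt_int _ (D * (t ^+ 2 - 4 * n))).
  rewrite !(rmorphM, rmorphB, rmorphXn) /= -ta -nb.
  by ring.
exists (D * t), c; rewrite xE qel_int qelM rmorphM /=; congr qel.
  by rewrite rmorphM /= -ta; ring.
by rewrite -cE; ring.
Qed.

Lemma OK_sqrt : OK s.
Proof.
have -> : s = qel 0 1 by rewrite /qel rmorph0 rmorph1 add0r mul1r.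
apply: (@OK_tr_nm _ 0 (- D)) => //; first exact: K_qel.
  by rewrite tr_qel mulr0.
by rewrite nm_qel rmorphN /=; ring.
Qed.

Lemma OK_qel (X Y : int) : OK (qel X%:~R Y%:~R).
Proof.
rewrite /qel !ratr_int; apply: OKD; first exact: OK_int.
by apply: OKM; [exact: OK_int|exact: OK_sqrt].
Qed.

Lemma K_denom x : K x -> exists2 d : int, d != 0 & OK (d%:~R * x).
Proof.
move=> /qelP[a [b ->]]; exists (denq a * denq b); first by rewrite mulf_neq0 ?denq_neq0.
have -> : (denq a * denq b)%:~R * qel a b = qel (denq b * numq a)%:~R (denq a * numq b)%:~R.
  rewrite qel_int qelM !rmorphM /= !numqE; congr qel; ring.
exact: OK_qel.
Qed.

End QuadraticField.

(** * Units of a real quadratic field *)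

Section Units.

Context (D : int) {rqD : real_quadratic D}.

Local Notation K := (Qsqrt D).
Local Notation OK := (ring_of_integers K).
Local Notation cj := (cj D).
Local Notation tr := (tr D).
Local Notation nm := (nm D).

(** Nonzero u is imposed because the inverse of 0 is 0. *)
Definition OK_unit u := [/\ OK u, u != 0 & OK u^-1].

Lemma unit_K u : OK_unit u -> K u. Proof. by case=> -[]. Qed.

Lemma unit1 : OK_unit 1.
Proof. by split; rewrite ?invr1 ?oner_neq0 //; exact: OK1. Qed.

Lemma unitM u v : OK_unit u -> OK_unit v -> OK_unit (u * v).
Proof.
move=> [Ou u0 Oiu] [Ov v0 Oiv].
by split; rewrite ?mulf_neq0 ?invfM //; exact: OKM.
Qed.

Lemma unitV u : OK_unit u -> OK_unit u^-1.
Proof. by move=> [Ou u0 Oiu]; split; rewrite ?invr_eq0 ?invrK. Qed.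

Lemma unitN u : OK_unit u -> OK_unit (- u).
Proof.
by move=> [Ou u0 Oiu]; split; rewrite ?oppr_eq0 ?invrN //; exact: OKN.
Qed.

Lemma unitX u n : OK_unit u -> OK_unit (u ^+ n).
Proof.
move=> Uu; elim: n => [|n IHn]; first by rewrite expr0; exact: unit1.
by rewrite exprS; exact: unitM.
Qed.

Lemma unitXz u (k : int) : OK_unit u -> OK_unit (u ^ k).
Proof.
move=> Uu; case: k => n; first exact: unitX.
by rewrite NegzE -exprnN; exact/unitV/unitX.
Qed.

Lemma unit_sqr_nm u : OK_unit u -> nm (u ^+ 2) = 1.
Proof.
move=> [Ou u0 Oiu]; have [m mE] := OK_nmP Ou; have [n nE] := OK_nmP Oiu.
have mn : m * n = 1.
  apply: (@intr_inj rat); rewrite rmorphM /= -mE -nE -nmM ?divff //.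
  - exact: nm1.
  - exact: OK_K Ou.
  - exact: OK_K Oiu.
have m2 : m * m = 1.
  have /eqP := congr1 absz mn; rewrite abszM muln_eq1 => /andP[/eqP m1 _].
  by move: m1; lia.
by rewrite expr2 (nmM (OK_K Ou) (OK_K Ou)) mE -rmorphM /= m2 rmorph1.
Qed.

Lemma unit_tr_sqr u : OK_unit u -> ratr (tr (u ^+ 2)) = u ^+ 2 + u ^- 2.
Proof.
move=> Uu; have Ku2 : K (u ^+ 2) by apply: KX; exact: unit_K.
have [_ u0 _] := Uu.
rewrite -addr_cj //; congr (_ + _).
apply: (@mulfI _ (u ^+ 2)); first by rewrite expf_eq0.
by rewrite mulr_cj // unit_sqr_nm // rmorph1 divff // expf_eq0.
Qed.

(** The map t |-> t + 1/t increases for t >= 1.  So on squares of units >= 1,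
whose trace is a natural number, the trace orders units like natural numbers:
this replaces the discreteness of the logarithmic embedding. *)
Lemma unit_tr_mono u v : OK_unit u -> OK_unit v -> 1 <= u -> u < v ->
  tr (u ^+ 2) < tr (v ^+ 2).
Proof.
move=> Uu Uv u1 uv; rewrite -(ltr_rat algC) !unit_tr_sqr //.
have u_gt0 : 0 < u by apply: lt_le_trans u1.
have v_gt0 : 0 < v by apply: lt_trans uv.
have x0 : 0 < u ^+ 2 by rewrite exprn_gt0.
have y0 : 0 < v ^+ 2 by rewrite exprn_gt0.
have xy : u ^+ 2 < v ^+ 2 by rewrite ltrXn2r // ltW.
have x1 : 1 <= u ^+ 2 by rewrite exprn_ege1.
move: (u ^+ 2) (v ^+ 2) x0 y0 xy x1 => x y x0 y0 xy x1.
rewrite -subr_gt0.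
have -> : y + y^-1 - (x + x^-1) = (y - x) * (1 - (x * y)^-1).
  by field; rewrite !gt_eqF.
apply: mulr_gt0; rewrite subr_gt0 // invf_lt1 ?mulr_gt0 //.
apply: (lt_le_trans (le_lt_trans x1 xy)).
by rewrite ler_peMl // ltW.
Qed.

Lemma unit_tr_nat u : OK_unit u -> 1 <= u -> exists t : nat, tr (u ^+ 2) = t%:R.
Proof.
move=> Uu u1; have [Ou _ _] := Uu; have [t tE] := OK_trP (OKX 2 Ou).
have u0 : 0 < u by apply: lt_le_trans u1.
suff : 0 <= t by case: t tE => // n -> _; exists n.
rewrite -(ler0z rat) -tE -(ler_rat algC) rmorph0 unit_tr_sqr //.
by rewrite addr_ge0 // ?invr_ge0 exprn_ge0 // ltW.
Qed.

Lemma min_unit : (exists u, OK_unit u /\ 1 < u) ->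
  exists e, [/\ OK_unit e, 1 < e & forall u, OK_unit u -> 1 < u -> e <= u].
Proof.
move=> exu; pose P t := `[< exists u, [/\ OK_unit u, 1 < u & tr (u ^+ 2) = t%:R] >].
have exP : exists t, P t.
  have [u [Uu u1]] := exu; have [t tE] := unit_tr_nat Uu (ltW u1).
  by exists t; apply/asboolP; exists u.
case: (ex_minnP exP) => t /asboolP[e [Ue e1 te]] tmin; exists e; split=> // u Uu u1.
rewrite real_leNgt ?(Kreal (unit_K Ue)) ?(Kreal (unit_K Uu)) //; apply/negP => ue.
have [t' tE'] := unit_tr_nat Uu (ltW u1).
have := tmin t'; rewrite leqNgt => /(_ _)/negP; apply.
  by apply/asboolP; exists u.
by rewrite -(ltr_nat rat) -te -tE'; apply: unit_tr_mono => //; exact: ltW.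
Qed.

(** Division by e, by induction on the trace of the square: as long as w > 1,
minimality of e gives w >= e, and w / e is a smaller unit >= 1. *)
Lemma unit_pow_min e : OK_unit e -> 1 < e ->
  (forall u, OK_unit u -> 1 < u -> e <= u) ->
  forall w, OK_unit w -> 1 <= w -> exists k : nat, w = e ^+ k.
Proof.
move=> Ue e1 emin w Uw w1; have [t tE] := unit_tr_nat Uw w1.
have [n] := ubnP t; elim: n t w Uw w1 tE => // n IHn t w Uw w1 tE tn.
have [->|wn1] := eqVneq w 1; first by exists 0%N.
have {wn1}w_gt1 : 1 < w by rewrite lt_neqAle eq_sym wn1.
have ew := emin w Uw w_gt1.
have e0 : 0 < e by apply: lt_trans e1.
have w'1 : 1 <= w / e by rewrite ler_pdivlMr // mul1r.
have Uw' : OK_unit (w / e) by apply: unitM => //; exact: unitV.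
have [t' t'E] := unit_tr_nat Uw' w'1.
have w'w : w / e < w.
  by rewrite ltr_pdivrMr // ltr_pMr // (lt_trans _ w_gt1).
have t't : (t' < t)%N.
  by rewrite -(ltr_nat rat) -tE -t'E; apply: unit_tr_mono.
have [|k kE] := IHn t' (w / e) Uw' w'1 t'E; first exact: leq_trans t't tn.
by exists k.+1; rewrite exprSr -kE divfK // gt_eqF.
Qed.

(** The rank of the unit group is at most one; e = 1 covers the case in which
there is no unit above 1. *)
Lemma unit_generator : exists2 e, OK_unit e &
  forall u, OK_unit u -> exists k : int, u = e ^ k \/ u = - e ^ k.
Proof.
have [exu|nexu] := pselect (exists u, OK_unit u /\ 1 < u).
  have [e [Ue e1 emin]] := min_unit exu; exists e => // u Uu.
  have pos v : OK_unit v -> 0 < v -> exists k : int, v = e ^ k.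
    move=> Uv v0; have [v1|v1] := real_leP (real1 _) (Kreal (unit_K Uv)).
      by have [k ->] := unit_pow_min Ue e1 emin Uv v1; exists k.
    have [|k kE] := unit_pow_min Ue e1 emin (unitV Uv).
      by rewrite invf_ge1 // ltW.
    by exists (- k%:Z); rewrite -exprnN -kE invrK.
  have [u0|u0] := real_leP (Kreal (unit_K Uu)) (real0 _); last first.
    by have [k ->] := pos u Uu u0; exists k; left.
  have [||k kE] := pos (- u); first exact: unitN.
    by rewrite oppr_gt0 lt_neqAle u0 andbT; case: Uu.
  by exists k; right; rewrite -kE opprK.
exists 1; first exact: unit1.
have le1 v : OK_unit v -> v <= 1.
  move=> Uv; rewrite real_leNgt ?(Kreal (unit_K Uv)) ?real1 //.
  by apply/negP => v1; apply: nexu; exists v.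
have pos1 v : OK_unit v -> 0 < v -> v = 1.
  move=> Uv v0; apply: le_anti; rewrite le1 //=.
  by rewrite -invf_le1 // le1 //; exact: unitV.
move=> u Uu; exists 0; rewrite expr0z.
have [u0|u0] := real_leP (Kreal (unit_K Uu)) (real0 _); last by left; exact: pos1.
right; rewrite -[u]opprK; congr (- _); apply: pos1; first exact: unitN.
by rewrite oppr_gt0 lt_neqAle u0 andbT; case: Uu.
Qed.

(** Write eps = +-e^a and u = +-e^b.  Since eps is not plus or minus a p-th
power, a is prime to p, so b = a i + p f for some i and f. *)
Lemma unit_mod_powers (eps : algC) (p : nat) :
  OK_unit eps -> prime p ->
  (forall v, K v -> eps <> v ^+ p /\ eps <> - v ^+ p) ->
  forall u, OK_unit u -> exists i : nat, exists2 v, OK_unit v &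
    u = eps ^+ i * v ^+ p \/ u = - (eps ^+ i * v ^+ p).
Proof.
move=> Ueps pp neps u Uu; have [e Ue gen] := unit_generator.
have [a aE] := gen _ Ueps; have [b bE] := gen _ Uu.
have e0 : e != 0 by case: Ue.
have cop : gcdz a p = 1.
  suff : coprime p `|a| by rewrite coprime_sym => /eqP; rewrite /gcdz => ->.
  rewrite prime_coprime //; apply/negP => pa.
  have /dvdzP[a' a'E] : (p%:Z %| a)%Z by rewrite dvdzE.
  have [n1 n2] := neps _ (unit_K (unitXz a' Ue)).
  by case: aE; rewrite a'E -exprz_exp -exprnP => ?; [exact: n1|exact: n2].
have [x [y xy]] := Bezoutz a p.
rewrite cop in xy.
pose i := ((b * x) %% p)%Z; pose q := ((b * x) %/ p)%Z.
pose f := a * q + b * y.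
have i0 : 0 <= i by apply: modz_ge0; rewrite eqz_nat -lt0n prime_gt0.
have iE : i = `|i|%N by rewrite gez0_abs.
have bE' : b = a * i + p%:Z * f.
  have bx : b * x = q * p + i by exact: divz_eq.
  rewrite /f.
  have -> : a * i + p%:Z * (a * q + b * y) = a * (q * p%:Z + i) + b * (y * p%:Z) by ring.
  rewrite -bx.
  have -> : a * (b * x) + b * (y * p%:Z) = b * (x * a + y * p%:Z) by ring.
  by rewrite xy mulr1.
exists `|i|%N; exists (e ^ f); first exact: unitXz.
have ebE : e ^ b = (e ^ a) ^+ `|i|%N * (e ^ f) ^+ p.
  by rewrite !exprnP !exprz_exp -iE -expfzDr // bE' [f * _]mulrC.
have sgn (t : algC) : (- t) ^+ `|i| = t ^+ `|i| \/ (- t) ^+ `|i| = - t ^+ `|i|.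
  rewrite exprNn -signr_odd; case: (odd _); rewrite ?expr1 ?mulN1r; [by right|].
  by left; rewrite expr0 mul1r.
case: aE => ->; case: bE => ->; rewrite ebE; try by [left|right].
  by case: (sgn (e ^ a)) => ->; [left|right; rewrite mulNr opprK].
by case: (sgn (e ^ a)) => ->; [right|left; rewrite mulNr].
Qed.

End Units.

(** * Reduction of integers at primes of degree one, and power classes *)

Lemma Aint_root n (x : algC) : (0 < n)%N -> x ^+ n \in Aint -> x \in Aint.
Proof.
move=> n0 Ax; apply: (@root_monic_Aint (minCpoly (x ^+ n) \Po 'X^n)).
- by rewrite rootE horner_comp hornerXn; exact: root_minCpoly.
- rewrite monicE lead_coef_comp ?size_polyXn ?ltnS // lead_coefXn expr1n mulr1.
  by rewrite -monicE; exact: minCpoly_monic.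
by rewrite polyOver_comp // rpredX // polyOverX.
Qed.

Section Residues.

Context (D : int) {rqD : real_quadratic D}.

Local Notation K := (Qsqrt D).
Local Notation OK := (ring_of_integers K).
Local Notation qel := (qel D).

Variables (F : fieldType) (dl : F).
Hypothesis dlE : dl ^+ 2 = D%:~R.
Hypothesis D2F : (2 * D)%:~R != 0 :> F.

(** The residue map that sends sqrt D to dl.  By [OK_coord], 2 D x has integer
coordinates when x is an integer of the field, and 2 D is invertible in F. *)
Definition res (x : algC) : F :=
  ((numq (qre D ((2 * D)%:~R * x)))%:~R
   + (numq (qim D ((2 * D)%:~R * x)))%:~R * dl) / (2 * D)%:~R.

Lemma res_coord x (X Y : int) : (2 * D)%:~R * x = qel X%:~R Y%:~R ->
  res x = (X%:~R + Y%:~R * dl) / (2 * D)%:~R.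
Proof. by move=> xE; rewrite /res xE qre_qel qim_qel !numq_int. Qed.

Lemma res_qel (X Y : int) : res (qel X%:~R Y%:~R) = X%:~R + Y%:~R * dl.
Proof.
have := @res_coord (qel X%:~R Y%:~R) (2 * D * X) (2 * D * Y).
rewrite (qel_int D) qelM => ->; last by congr (qel _ _); rewrite !rmorphM /=; ring.
rewrite !(intrM _ (2 * D)) /= -mulrA -mulrDr mulrC mulKf //.
Qed.

Lemma res_int (n : int) : res n%:~R = n%:~R.
Proof. by rewrite (qel_int D) (res_qel n 0) rmorph0 mul0r addr0. Qed.

Lemma resM x y : OK x -> OK y -> res (x * y) = res x * res y.
Proof.
move=> Ox Oy; have [X [Y xE]] := OK_coord Ox.
have [X' [Y' yE]] := OK_coord Oy; have [X2 [Y2 zE]] := OK_coord (OKM Ox Oy).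
rewrite (res_coord xE) (res_coord yE) (res_coord zE).
have [H1 H2] : X * X' + D * Y * Y' = 2 * D * X2 /\ X * Y' + Y * X' = 2 * D * Y2.
  have : (2 * D)%:~R * ((2 * D)%:~R * (x * y)) = qel X%:~R Y%:~R * qel X'%:~R Y'%:~R.
    by rewrite -xE -yE; ring.
  rewrite zE (qel_int D) !qelM => /qel_inj[H1 H2].
  by split; apply: (@intr_inj rat); [move: H1|move: H2];
     rewrite !(rmorphM, rmorphD) /= => <-; ring.
apply: (mulfI D2F); apply: (mulfI D2F).
transitivity ((2 * D * X2)%:~R + (2 * D * Y2)%:~R * dl).
  by rewrite !(intrM _ (2 * D)); move: D2F; set c : F := (2 * D)%:~R => c0; clearbody c; field.
rewrite -H1 -H2; move: D2F; set c : F := (2 * D)%:~R => c0.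
by rewrite !(intrM, intrD) -dlE; clearbody c; field.
Qed.

Lemma res1 : res 1 = 1. Proof. exact: (res_int 1). Qed.

Lemma resN x : OK x -> res (- x) = - res x.
Proof.
move=> Ox; have -> : - x = (-1)%:~R * x by rewrite mulN1r.
by rewrite resM ?res_int ?mulN1r //; exact: OK_int.
Qed.

Lemma resX x n : OK x -> res (x ^+ n) = res x ^+ n.
Proof.
move=> Ox; elim: n => [|n IHn]; first by rewrite !expr0 res1.
by rewrite !exprS resM ?IHn //; exact: OKX.
Qed.

Lemma res_unit u : OK_unit D u -> res u != 0.
Proof.
move=> [Ou u0 Oiu]; apply/eqP => ru.
have := res1; rewrite -(divff u0) resM // ru mul0r => /eqP.
by rewrite eq_sym oner_eq0.
Qed.

End Residues.

Section PowerClasses.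

Context (D : int) {rqD : real_quadratic D}.

Local Notation K := (Qsqrt D).
Local Notation OK := (ring_of_integers K).

Lemma OK_root n x : (0 < n)%N -> K x -> OK (x ^+ n) -> OK x.
Proof. by move=> n0 Kx [_ Ax]; split=> //; exact: Aint_root Ax. Qed.

Lemma unit_root n x : (0 < n)%N -> K x -> OK_unit D (x ^+ n) -> OK_unit D x.
Proof.
move=> n0 Kx [Ox x0 Oix]; split; first exact: OK_root Ox.
  by apply: contra_neq x0 => ->; rewrite expr0n eqn0Ngt n0.
by apply: (OK_root n0); [exact: KV|rewrite exprVn].
Qed.

(** With d = gcd(k, N) and a k = b N + d, al^d is a unit times be'^N; hence
(al / be'^(N/d))^d is a unit, and so is al / be'^(N/d).  Any prime factor p of
N/d does. *)
Lemma power_class_descent (N k : nat) (al be u : algC) :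
  (0 < k < N)%N -> K al -> al != 0 -> K be -> OK_unit D u ->
  al ^+ k = u * be ^+ N ->
  exists p, [/\ prime p, (p %| N)%N & exists w ga,
    [/\ OK_unit D w, K ga & al = w * ga ^+ p]].
Proof.
move=> /andP[k0 kN] Kal al0 Kbe Uu E.
case: (egcdnP N k0) => a b ab _; set d := gcdn k N in ab.
have d0 : (0 < d)%N by rewrite gcdn_gt0 k0.
have /dvdnP[N1 NE] : (d %| N)%N by exact: dvdn_gcdr.
have N1_gt1 : (1 < N1)%N.
  have dk : (d <= k)%N by apply: dvdn_leq => //; exact: dvdn_gcdl.
  by move: (leq_ltn_trans dk kN); rewrite NE; case: N1 {NE} => [|[|//]]; lia.
have be0 : be != 0.
  apply: contra_eq_neq E => ->; rewrite expr0n gtn_eqF ?mulr0 ?expf_neq0 //.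
  exact: leq_ltn_trans kN.
pose be' := be ^+ a / al ^+ b.
have Kbe' : K be' by apply: KM; [exact: KX|apply: KV; exact: KX].
have E' : al ^+ d = u ^+ a * be' ^+ N.
  apply: (@mulfI _ (al ^+ (b * N))); first by rewrite expf_neq0.
  rewrite -exprD -ab mulnC exprM E exprMn /be' expr_div_n.
  rewrite -!exprM [(N * a)%N]mulnC mulrCA; congr (_ * _).
  by rewrite mulrC divfK // expf_neq0.
exists (pdiv N1); split.
- exact: pdiv_prime.
- by rewrite NE dvdn_mulr // pdiv_dvd.
have /dvdnP[N2 N2E] := pdiv_dvd N1.
have Kw : K (al / be' ^+ N1) by apply: KM => //; apply: KV; exact: KX.
have be'0 : be' != 0 by rewrite mulf_neq0 ?invr_eq0 ?expf_neq0.
exists (al / be' ^+ N1), (be' ^+ N2); split; first 2 last.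
- by rewrite -exprM -N2E divfK // expf_neq0.
- apply: (@unit_root d) => //.
  rewrite expr_div_n -exprM -NE E' mulfK ?expf_neq0 //; exact: unitX.
exact: KX.
Qed.

End PowerClasses.

(** * Certificates for an element of order N *)

(** Numerical data that forces the ideal (z, x + y sqrt D) to have order N.  The
unit is (A + B sqrt D)^2 / k, which has norm 1 and trace 4 A^2 / k + 2; the
conditions on squares prevent it from being plus or minus a square, and the last
two fields are the two reductions that separate x + y sqrt D from units times
p-th powers.  Equations in F are multiplied by k in order to avoid quotients. *)
Record certificate (N : nat) (D x y z A B k : int) : Prop := Certificate {
  cert_norm : x ^+ 2 - D * y ^+ 2 = z ^+ N;
  cert_coprime : coprimez (2 * x) z;
  cert_unit : A ^+ 2 + k = D * B ^+ 2;
  cert_dvd : (k %| A)%Z;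
  cert_k_gt0 : 0 < k;
  cert_k_nonsquare : ~ perfect_square k;
  cert_kD_nonsquare : ~ perfect_square (k * D);
  cert_D_nonsquare : ~ perfect_square D;
  cert_generator : exists (F : fieldType) (dl i : F),
    [/\ dl ^+ 2 = D%:~R, (2 * D)%:~R != 0 :> F, i ^+ 2 = -1,
        k%:~R != 0 :> F /\
        (A%:~R + B%:~R * dl) ^+ 2 = - k%:~R * (x%:~R + y%:~R * dl) ^+ 2
      & forall p, prime p -> (p %| N)%N -> forall t : F,
          t ^+ p <> x%:~R + y%:~R * dl];
  cert_independent : exists (F : fieldType) (dl : F),
    [/\ dl ^+ 2 = D%:~R, (2 * D)%:~R != 0 :> F, x%:~R + y%:~R * dl = -1
      & forall p, prime p -> odd p -> (p %| N)%N -> forall t : F,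
          k%:~R * t ^+ p <> (A%:~R + B%:~R * dl) ^+ 2]
}.

Lemma cert_real N D x y z A B k :
  certificate N D x y z A B k -> real_quadratic D.
Proof.
move=> c; split; last exact: cert_D_nonsquare c.
have k0 := cert_k_gt0 c; have E := cert_unit c.
have : 0 < D * B ^+ 2 by rewrite -E ltr_wpDl ?sqr_ge0.
by rewrite pmulr_lgt0 // lt_neqAle sqr_ge0 andbT; apply/eqP => B0;
   move: E k0; rewrite -B0 mulr0; have := sqr_ge0 A; lia.
Qed.

Section Certificate.

Variables (N : nat) (D x y z A B k : int).
Hypothesis cert : certificate N D x y z A B k.

Let rqD : real_quadratic D := cert_real cert.
#[local] Existing Instance rqD.

Local Notation K := (Qsqrt D).
Local Notation OK := (ring_of_integers K).
Local Notation qel := (qel D).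

Let k_neq0 : k != 0. Proof. by rewrite gt_eqF // (cert_k_gt0 cert). Qed.

Definition cert_eps : algC := qel A%:~R B%:~R ^+ 2 / k%:~R.

Let eta : algC := qel A%:~R B%:~R.

Let K_eta : K eta. Proof. exact: K_qel. Qed.

Lemma nm_eta : nm D eta = - k%:~R.
Proof.
rewrite /eta nm_qel; have := congr1 (intr : int -> rat) (cert_unit cert).
by rewrite !(intrM, intrD, rmorphXn) /= => <-; ring.
Qed.

Let kC : k%:~R != 0 :> algC. Proof. by rewrite intr_eq0. Qed.

Lemma K_eps : K cert_eps.
Proof. by apply: KM; [exact: KX|apply: KV; exact: K_int]. Qed.

Lemma eps_mul : k%:~R * cert_eps = eta ^+ 2.
Proof. by rewrite /cert_eps mulrC divfK. Qed.

Lemma nm_eps : nm D cert_eps = 1.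
Proof.
apply: (@mulfI _ (k%:~R ^+ 2 : rat)); first by rewrite expf_neq0 // intr_eq0.
rewrite -(nm_int k) -nmM ?eps_mul ?expr2 ?nmM ?nm_eta //; last exact: K_eps.
  by rewrite nm_int; ring.
exact: K_int.
Qed.

Lemma tr_eps : exists t : int, tr D cert_eps = t%:~R.
Proof.
have /dvdzP[A' AE] := cert_dvd cert.
exists (4 * k * A' ^+ 2 + 2); apply: (fmorph_inj (@ratr algC)).
rewrite /= -addr_cj; last exact: K_eps.
apply: (mulfI kC); rewrite mulrDr eps_mul.
have -> : k%:~R * cj D cert_eps = cj D eta ^+ 2.
  by rewrite -(cj_int k) -cjM ?eps_mul ?cjX //; [exact: K_int|exact: K_eps].
have -> : eta ^+ 2 + cj D eta ^+ 2 = (eta + cj D eta) ^+ 2 - 2 * (eta * cj D eta) by ring.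
rewrite mulr_cj // addr_cj // nm_eta /eta tr_qel AE.
by rewrite !(rmorphM, rmorphD, rmorphN, rmorphXn, ratr_int) /=; ring.
Qed.

Lemma OK_eps : OK cert_eps.
Proof. by have [t tE] := tr_eps; exact: (OK_tr_nm (n := 1) K_eps tE nm_eps). Qed.

Lemma unit_eps : OK_unit D cert_eps.
Proof.
have e1 : cert_eps * cj D cert_eps = 1.
  by rewrite mulr_cj ?nm_eps ?rmorph1 //; exact: K_eps.
have e0 : cert_eps != 0.
  by apply: contra_eq_neq e1 => ->; rewrite mul0r eq_sym oner_eq0.
split=> //; first exact: OK_eps.
have -> : cert_eps^-1 = cj D cert_eps by apply: (mulfI e0); rewrite divff.
exact: OK_cj OK_eps.
Qed.

(** A square root of k in the field is rational, or a rational multiple of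
sqrt D, in which case k D is a square; and -k is negative in a real field. *)
Lemma k_not_square_in_K g : K g -> g ^+ 2 <> k%:~R /\ g ^+ 2 <> - k%:~R.
Proof.
have D0 : 0 < D by exact: radicand_gt0.
have k0 := cert_k_gt0 cert.
move=> Kg; split; last first.
  move=> g2; have : g \is Num.real by exact: Kreal Kg.
  rewrite realEsqr g2 oppr_ge0 lerz0.
  by rewrite leNgt k0.
case: (qelP Kg) => a [b ->]; rewrite expr2 qelM (qel_int D) => /qel_inj[E1 E2].
have : a * b = 0 by apply: (@mulfI _ 2) => //; rewrite mulr0 -E2; ring.
move/eqP; rewrite mulf_eq0 => /orP[] /eqP z0; move: E1; rewrite z0.
- rewrite mul0r add0r => E1.
  have [n nE] : exists n : int, D%:~R * b = n%:~R.
    by apply: (@rat_sqrt_int _ (k * D)); rewrite intrM -E1; ring.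
  apply: (cert_kD_nonsquare cert); exists n; apply: (@intr_inj rat).
  by rewrite rmorphXn /= -nE intrM -E1; ring.
rewrite !mulr0 addr0 -expr2 => E1; have [n nE] := rat_sqrt_int E1.
apply: (cert_k_nonsquare cert); exists n; apply: (@intr_inj rat).
by rewrite rmorphXn /= -nE.
Qed.

Lemma res_eps (F : fieldType) (dl : F) : dl ^+ 2 = D%:~R ->
  (2 * D)%:~R != 0 :> F ->
  k%:~R * res D dl cert_eps = (A%:~R + B%:~R * dl) ^+ 2.
Proof.
move=> dlE D2; rewrite -(res_int dl D2) -resM //; last exact: OK_eps.
  by rewrite eps_mul resX ?res_qel //; exact: OK_qel.
exact: OK_int.
Qed.

(** For p = 2, a square root v of +-eps would make eta / v a square root of +-k.
For p odd, the second reduction of the certificate shows it. *)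
Lemma eps_not_power p : prime p -> (p %| N)%N ->
  forall v, K v -> cert_eps <> v ^+ p /\ cert_eps <> - v ^+ p.
Proof.
move=> pp pN; have [p2|podd] : p = 2%N \/ odd p by case: (even_prime pp); auto.
  move=> v Kv; rewrite p2.
  have v0 : v ^+ 2 = cert_eps \/ v ^+ 2 = - cert_eps -> v != 0.
    have [_ e0 _] := unit_eps; case=> E; apply: contra_neq e0 => v0.
      by rewrite -E v0 expr0n.
    by apply/eqP; rewrite -oppr_eq0 -E v0 expr0n.
  have Kg : K (eta / v) by apply: KM => //; exact: KV.
  have [nk nNk] := k_not_square_in_K Kg.
  split=> E; [apply: nk|apply: nNk]; rewrite expr_div_n -eps_mul.
    by rewrite -E mulfK // E expf_neq0 // v0 //; left.
  have vE : v ^+ 2 = - cert_eps by rewrite E opprK.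
  by rewrite vE invrN mulrN mulfK //; case: unit_eps.
have npow v : K v -> cert_eps <> v ^+ p.
  move=> Kv E; have Ov : OK v.
    by apply: (OK_root (prime_gt0 pp)) => //; rewrite -E; exact: OK_eps.
  have [F [dl [dlE D2 _ /(_ p pp podd pN (res D dl v)) npw]]] := cert_independent cert.
  by apply: npw; rewrite -resX // -E; exact: res_eps.
move=> v Kv; split; first exact: npow.
have := npow (- v) (KN Kv).
by rewrite exprNn -signr_odd podd expr1 mulN1r.
Qed.

Definition cert_alpha : algC := qel x%:~R y%:~R.

Lemma OK_alpha : OK cert_alpha. Proof. exact: OK_qel. Qed.

(** Here alpha = +-eps^i beta^p with beta = v g.  For p = 2, the first reduction
sends eps to -alpha^2, a square since -1 is one, and alpha would be a square.
For p odd, the second reduction sends alpha to -1, so eps^i is a p-th power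
there although eps is not, and p | i; then alpha is a p-th power in the first
reduction. *)
Lemma alpha_not_unit_mul_power p w g : prime p -> (p %| N)%N ->
  OK_unit D w -> K g -> cert_alpha <> w * g ^+ p.
Proof.
move=> pp pN Uw Kg E.
have Og : OK g.
  apply: (OK_root (prime_gt0 pp)) => //; have [_ w0 Oiw] := Uw.
  have -> : g ^+ p = cert_alpha * w^-1 by rewrite E mulrC mulKf.
  exact: OKM OK_alpha Oiw.
have [i [v Uv wE]] := unit_mod_powers unit_eps pp (eps_not_power pp pN) Uw.
have Ov : OK v by case: Uv.
have Oe := OK_eps.
have {}wE : cert_alpha = cert_eps ^+ i * (v * g) ^+ p \/
            cert_alpha = - (cert_eps ^+ i * (v * g) ^+ p).
  by rewrite E [(v * g) ^+ p]exprMn mulrA; case: wE => ->; [left|right]; rewrite ?mulNr.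
have Ovg := OKM Ov Og.
have [F [dl [ii [dlE D2 iiE [kF etaE] /(_ p pp pN) npw]]]] := cert_generator cert.
have resal : res D dl cert_alpha = x%:~R + y%:~R * dl by rewrite res_qel.
have epsF : res D dl cert_eps = - (x%:~R + y%:~R * dl) ^+ 2.
  apply: (mulfI kF); rewrite res_eps // etaE; ring.
have resE : forall (F' : fieldType) (dl' : F'), dl' ^+ 2 = D%:~R ->
  (2 * D)%:~R != 0 :> F' ->
  x%:~R + y%:~R * dl' = res D dl' cert_eps ^+ i * res D dl' (v * g) ^+ p \/
  x%:~R + y%:~R * dl' = - (res D dl' cert_eps ^+ i * res D dl' (v * g) ^+ p).
  move=> F' dl' dl'E D2'; rewrite -(res_qel dl' D2') -/cert_alpha.
  have H : res D dl' (cert_eps ^+ i * (v * g) ^+ p) =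
           res D dl' cert_eps ^+ i * res D dl' (v * g) ^+ p.
    by rewrite resM ?resX //; exact: OKX.
  case: wE => ->; [left|right]; rewrite ?resN ?H //.
  by apply: OKM; exact: OKX.
have [p2|podd] : p = 2%N \/ odd p by case: (even_prime pp); auto.
  have := resE F dl dlE D2; rewrite epsF p2 => H.
  have eE : (- (x%:~R + y%:~R * dl) ^+ 2) ^+ i = (ii ^+ i * (x%:~R + y%:~R * dl) ^+ i) ^+ 2 :> F.
    by rewrite -mulN1r -iiE -exprMn exprAC exprMn.
  case: H; rewrite eE => H.
    by apply: (npw (ii ^+ i * (x%:~R + y%:~R * dl) ^+ i * res D dl (v * g))); rewrite p2 exprMn -H.
  apply: (npw (ii * (ii ^+ i * (x%:~R + y%:~R * dl) ^+ i * res D dl (v * g)))).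
  by rewrite p2 [RHS]H exprMn iiE [(_ * res _ _ _) ^+ 2]exprMn mulN1r.
have [pi|npi] := boolP (p %| i)%N.
  have /dvdnP[i' iE] := pi; have := resE F dl dlE D2.
  rewrite iE exprM -exprMn => -[] H; first by apply: (npw _ (esym H)).
  apply: (npw (- (res D dl cert_eps ^+ i' * res D dl (v * g)))).
  by rewrite H exprNn -signr_odd podd expr1 mulN1r.
have [F' [dl' [dl'E D2' alE /(_ p pp podd pN) npw']]] := cert_independent cert.
have e0 : res D dl' cert_eps != 0 by apply: res_unit => //; exact: unit_eps.
set e := res D dl' cert_eps in e0.
have [t tE] : exists t, e ^+ i = t ^+ p.
  set q := res D dl' (v * g).
  have q0 : q != 0.
    apply/eqP => q0; have := resE F' dl' dl'E D2'.
    rewrite -/q q0 expr0n gtn_eqF ?prime_gt0 // !mulr0 oppr0 alE.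
    by case=> /eqP; rewrite oppr_eq0 oner_eq0.
  have := resE F' dl' dl'E D2'; rewrite -/q -/e alE => -[] H.
    exists (- q^-1); rewrite exprNn -signr_odd podd expr1 H exprVn mulfK //.
    by rewrite expf_neq0.
  exists q^-1; apply: oppr_inj; rewrite exprVn.
  by apply: (mulIf (x := q ^+ p)); rewrite ?expf_neq0 // mulNr -H mulNr mulVf ?expf_neq0.
have i0 : (0 < i)%N by rewrite lt0n; apply: contra npi => /eqP ->.
case: (egcdnP p i0) => a b ab _.
have gE : gcdn i p = 1%N.
  by apply/eqP; rewrite -/(coprime _ _) coprime_sym prime_coprime.
apply: (npw' (t ^+ a / e ^+ b)).
rewrite expr_div_n -!exprM [(a * p)%N]mulnC exprM -tE -exprM mulnC ab gE.
rewrite exprD expr1 [e ^+ _ * e]mulrC mulfK ?expf_neq0 //.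
exact: res_eps.
Qed.

Lemma alpha_power_not_principal j be u : (0 < j < N)%N -> cert_alpha != 0 ->
  K be -> OK_unit D u -> cert_alpha ^+ j <> u * be ^+ N.
Proof.
move=> jN al0 Kbe Uu E.
have Kal : K cert_alpha by exact: K_qel.
have [p [pp pN [w [g [Uw Kg]]]]] := power_class_descent jN Kal al0 Kbe Uu E.
exact: alpha_not_unit_mul_power.
Qed.

End Certificate.

(** * Fractional ideals and their classes *)

Section Ideals.

Context (D : int) {rqD : real_quadratic D}.

Local Notation K := (Qsqrt D).
Local Notation OK := (ring_of_integers K).
Local Notation fid := (fractional_ideal K).
Local Notation cls := (ideal_class K).

Implicit Types I J L : set algC.

Lemma mem_ideal_mul I J x y : I x -> J y -> ideal_mul I J (x * y).
Proof.
move=> Ix Jy; exists [:: (x, y)]; last by rewrite big_seq1.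
by move=> p; rewrite inE => /eqP ->.
Qed.

Lemma ideal_mul0 I J : ideal_mul I J 0.
Proof. by exists [::] => //; rewrite big_nil. Qed.

Lemma ideal_mulD I J x y :
  ideal_mul I J x -> ideal_mul I J y -> ideal_mul I J (x + y).
Proof.
move=> [s sP ->] [t tP ->]; exists (s ++ t); last by rewrite big_cat.
by move=> p; rewrite mem_cat => /orP[/sP|/tP].
Qed.

Lemma ideal_mul_sub I J (H : set algC) : H 0 ->
  (forall x y, H x -> H y -> H (x + y)) ->
  (forall x y, I x -> J y -> H (x * y)) -> ideal_mul I J `<=` H.
Proof.
move=> H0 HD HM _ [s sP ->]; elim: s sP => [|p s IHs] sP; first by rewrite big_nil.
rewrite big_cons; apply: HD.
  by have [? ?] := sP p (mem_head _ _); exact: HM.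
by apply: IHs => q qs; apply: sP; rewrite inE qs orbT.
Qed.

Lemma ideal_mulS I J I' J' : I `<=` I' -> J `<=` J' ->
  ideal_mul I J `<=` ideal_mul I' J'.
Proof.
move=> sI sJ; apply: ideal_mul_sub.
- exact: ideal_mul0.
- exact: ideal_mulD.
by move=> x y /sI Ix /sJ Jy; exact: mem_ideal_mul.
Qed.

Lemma ideal_mulC I J : ideal_mul I J = ideal_mul J I.
Proof.
suff sub A B : ideal_mul A B `<=` ideal_mul B A by apply/seteqP; split; exact: sub.
apply: ideal_mul_sub => [|x y|x y Ax By]; [exact: ideal_mul0|exact: ideal_mulD|].
by rewrite mulrC; exact: mem_ideal_mul.
Qed.

Lemma ideal_mulA I J L : ideal_mul I (ideal_mul J L) = ideal_mul (ideal_mul I J) L.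
Proof.
have sub A B C : ideal_mul A (ideal_mul B C) `<=` ideal_mul (ideal_mul A B) C.
  apply: ideal_mul_sub => [|x y|x y Ax]; [exact: ideal_mul0|exact: ideal_mulD|].
  move: y; apply: (@ideal_mul_sub B C [set y | ideal_mul (ideal_mul A B) C (x * y)]).
  - by rewrite /= mulr0; exact: ideal_mul0.
  - by move=> y z /=; rewrite mulrDr; exact: ideal_mulD.
  move=> y z By Cz /=; rewrite mulrA.
  by apply: mem_ideal_mul => //; exact: mem_ideal_mul.
apply/seteqP; split; first exact: sub.
rewrite [ideal_mul (ideal_mul I J) L]ideal_mulC [ideal_mul I (ideal_mul J L)]ideal_mulC.
rewrite [ideal_mul I J]ideal_mulC [ideal_mul J L]ideal_mulC; exact: sub.
Qed.

Definition prid (x : algC) : set algC := [set x * y | y in OK].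

Lemma mem_prid x : prid x x.
Proof. by exists 1; rewrite ?mulr1 //; exact: OK1. Qed.

Lemma prid1 : prid 1 = OK.
Proof.
apply/seteqP; split=> [_ [y Oy <-]|y Oy]; first by rewrite mul1r.
by exists y; rewrite ?mul1r.
Qed.

Section Fractional.

Variable I : set algC.
Hypothesis fI : fid I.

Lemma fid_K x : I x -> K x. Proof. by case: fI => sI *; exact: sI. Qed.
Lemma fidB x y : I x -> I y -> I (x - y). Proof. by case: fI => *; auto. Qed.
Lemma fidM a x : OK a -> I x -> I (a * x). Proof. by case: fI => *; auto. Qed.
Lemma fid0 : I 0.
Proof. by case: fI => _ [x Ix _] *; rewrite -(subrr x); exact: fidB. Qed.
Lemma fidN x : I x -> I (- x).
Proof. by move=> Ix; rewrite -sub0r; apply: fidB => //; exact: fid0. Qed.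
Lemma fidD x y : I x -> I y -> I (x + y).
Proof. by move=> Ix Iy; rewrite -[y]opprK; apply: fidB => //; exact: fidN. Qed.

End Fractional.

Lemma fid_mul I J : fid I -> fid J -> fid (ideal_mul I J).
Proof.
move=> fI fJ; split.
- apply: ideal_mul_sub => [|x y|x y /(fid_K fI) Kx /(fid_K fJ) Ky].
  + exact: K0.
  + exact: KD.
  + exact: KM.
- have [_ [x Ix x0] _ _ _] := fI; have [_ [y Jy y0] _ _ _] := fJ.
  by exists (x * y); rewrite ?mulf_neq0 //; exact: mem_ideal_mul.
- move=> x y Hx [s sP ->]; apply: ideal_mulD => //.
  exists [seq (- p.1, p.2) | p <- s].
    by move=> _ /mapP[p /sP[Ip Jp] ->]; split=> //=; exact: (fidN fI).
  by rewrite big_map -sumrN; apply: eq_bigr => p _; rewrite mulNr.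
- move=> a x Oa [s sP ->]; exists [seq (a * p.1, p.2) | p <- s].
    by move=> _ /mapP[p /sP[Ip Jp] ->]; split=> //=; exact: (fidM fI).
  by rewrite big_map mulr_sumr; apply: eq_bigr => p _; rewrite mulrA.
have [_ _ _ _ [d [Od d0 dI]]] := fI; have [_ _ _ _ [e [Oe e0 eJ]]] := fJ.
exists (d * e); split; [exact: OKM|by rewrite mulf_neq0|].
apply: (@ideal_mul_sub I J [set x | OK (d * e * x)]).
- by rewrite /= mulr0; exact: OK0.
- by move=> x y /=; rewrite mulrDr; exact: OKD.
by move=> x y Ix Jy /=; rewrite mulrACA; apply: OKM; [exact: dI|exact: eJ].
Qed.

Lemma fid_scale x I : K x -> x != 0 -> fid I -> fid [set x * y | y in I].
Proof.
move=> Kx x0 fI; split.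
- by move=> _ [y Iy <-]; apply: KM => //; exact: (fid_K fI).
- have [_ [y Iy y0] _ _ _] := fI.
  by exists (x * y); [exists y|rewrite mulf_neq0].
- by move=> _ _ [y Iy <-] [z Iz <-]; exists (y - z); rewrite ?mulrBr //; exact: (fidB fI).
- by move=> a _ Oa [y Iy <-]; exists (a * y); [exact: (fidM fI)|rewrite mulrCA].
have [_ _ _ _ [d [Od d0 dI]]] := fI; have [c c0 Oc] := K_denom Kx.
exists (c%:~R * d); split; first by apply: OKM => //; exact: OK_int.
  by rewrite mulf_neq0 // intr_eq0.
by move=> _ [y Iy <-]; rewrite mulrACA; apply: OKM => //; exact: dI.
Qed.

Lemma fid_OK : fid OK.
Proof.
split; first by move=> x; exact: OK_K.
- by exists 1; rewrite ?oner_neq0 //; exact: OK1.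
- by move=> x y; exact: OKB.
- by move=> a x; exact: OKM.
by exists 1; split; rewrite ?oner_neq0 //; [exact: OK1|move=> x; rewrite mul1r].
Qed.

Lemma fid_prid x : K x -> x != 0 -> fid (prid x).
Proof. by move=> Kx x0; apply: fid_scale => //; exact: fid_OK. Qed.

Lemma prid_mul x I : fid I -> ideal_mul (prid x) I = [set x * y | y in I].
Proof.
move=> fI; apply/seteqP; split; last first.
  by move=> _ [y Iy <-]; apply: mem_ideal_mul => //; exact: mem_prid.
apply: ideal_mul_sub.
- by exists 0; [exact: (fid0 fI)|rewrite mulr0].
- by move=> _ _ [y Iy <-] [z Iz <-]; exists (y + z); rewrite ?mulrDr //; exact: (fidD fI).
by move=> _ y [a Oa <-] Iy; exists (a * y); rewrite ?mulrA //; exact: (fidM fI).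
Qed.

Lemma OK_mul I : fid I -> ideal_mul OK I = I.
Proof.
move=> fI; rewrite -prid1 prid_mul //; apply/seteqP; split=> [_ [y Iy <-]|y Iy].
  by rewrite mul1r.
by exists y; rewrite ?mul1r.
Qed.

Lemma prid_mul_prid x y : K y -> y != 0 -> ideal_mul (prid x) (prid y) = prid (x * y).
Proof.
move=> Ky y0; rewrite prid_mul; last exact: fid_prid.
apply/seteqP; split=> [_ [_ [a Oa <-] <-]|_ [a Oa <-]].
  by exists a; rewrite ?mulrA.
by exists (y * a); [exists a|rewrite mulrA].
Qed.

Lemma ideal_mul_prid_inj x I J : K x -> x != 0 -> fid I -> fid J ->
  ideal_mul (prid x) I = ideal_mul (prid x) J -> I = J.
Proof.
move=> Kx x0 fI fJ; rewrite !prid_mul // => E.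
have inj A : [set x^-1 * y | y in [set x * y | y in A]] = A.
  apply/seteqP; split=> [_ [_ [y Ay <-] <-]|y Ay]; first by rewrite mulKf.
  by exists (x * y); [exists y|rewrite mulKf].
by rewrite -(inj I) E inj.
Qed.

Lemma equivE I J : fid I ->
  ideal_equiv K I J <-> exists x, [/\ K x, x != 0 & J = ideal_mul (prid x) I].
Proof. by move=> fI; split=> -[x [Kx x0 ->]]; exists x; rewrite prid_mul. Qed.

Lemma equiv_refl I : ideal_equiv K I I.
Proof.
exists 1; split; [exact: K1|exact: oner_neq0|].
apply/seteqP; split=> [y Iy|_ [y Iy <-]]; last by rewrite mul1r.
by exists y; rewrite ?mul1r.
Qed.

Lemma equiv_sym I J : ideal_equiv K I J -> ideal_equiv K J I.
Proof.
move=> [x [Kx x0 ->]]; exists x^-1; split; [exact: KV|by rewrite invr_eq0|].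
apply/seteqP; split=> [y Iy|_ [_ [y Iy <-] <-]]; last by rewrite mulKf.
by exists (x * y); [exists y|rewrite mulKf].
Qed.

Lemma equiv_trans I J L :
  ideal_equiv K I J -> ideal_equiv K J L -> ideal_equiv K I L.
Proof.
move=> [x [Kx x0 ->]] [y [Ky y0 ->]]; exists (y * x); split.
- exact: KM.
- by rewrite mulf_neq0.
apply/seteqP; split=> [_ [_ [z Iz <-] <-]|_ [z Iz <-]].
  by exists z; rewrite ?mulrA.
by exists (x * z); [exists z|rewrite mulrA].
Qed.

Lemma cls_eq I J : fid J -> cls I = cls J <-> ideal_equiv K I J.
Proof.
move=> fJ; split=> [E|E].
  have : cls J J by split=> //; exact: equiv_refl.
  by rewrite -E => -[].
apply/seteqP; split=> L [fL]; split=> //; last exact: equiv_trans E _.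
exact: equiv_trans (equiv_sym E) _.
Qed.

Lemma cls_mulE I J : fid I -> fid J ->
  class_mul K (cls I) (cls J) = cls (ideal_mul I J).
Proof. by move=> fI fJ; apply: class_mulE => //; [exact: K1|exact: KM]. Qed.

Definition ipow I k := iter k (ideal_mul I) OK.

Lemma fid_ipow I k : fid I -> fid (ipow I k).
Proof. by move=> fI; elim: k => [|k IHk] /=; [exact: fid_OK|exact: fid_mul]. Qed.

Lemma cls_expE I k : fid I -> class_exp K (cls I) k = cls (ipow I k).
Proof.
move=> fI; elim: k => // k IHk.
by rewrite /class_exp iterS -/(class_exp _ _ _) IHk cls_mulE //; exact: fid_ipow.
Qed.

Lemma ipowD I a b : fid I -> ipow I (a + b) = ideal_mul (ipow I a) (ipow I b).
Proof.
move=> fI; elim: a => [|a IHa]; first by rewrite OK_mul //; exact: fid_ipow.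
by rewrite addSn /= -/(ipow _ _) IHa ideal_mulA.
Qed.

Lemma ipowM I a b : fid I -> ipow I (a * b) = ipow (ipow I a) b.
Proof.
by move=> fI; rewrite mulnC; elim: b => // b IHb; rewrite mulSn ipowD // IHb.
Qed.

Lemma ipow_mul I J k : fid I -> fid J ->
  ipow (ideal_mul I J) k = ideal_mul (ipow I k) (ipow J k).
Proof.
move=> fI fJ; elim: k => [|k IHk]; first by rewrite OK_mul //; exact: fid_OK.
rewrite /= -!/(ipow _ _) IHk !ideal_mulA; congr (ideal_mul _ _).
by rewrite -!ideal_mulA; congr (ideal_mul _ _); exact: ideal_mulC.
Qed.

Lemma ipow_prid x k : K x -> x != 0 -> ipow (prid x) k = prid (x ^+ k).
Proof.
move=> Kx x0; elim: k => [|k IHk]; first by rewrite expr0 prid1.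
rewrite /= -/(ipow _ _) IHk prid_mul_prid ?exprS ?expf_neq0 //; exact: KX.
Qed.

Lemma cls_one_eq I : fid I ->
  cls I = class_one K <-> exists x, [/\ K x, x != 0 & I = prid x].
Proof.
move=> fI; split=> [/esym/cls_eq|[x [Kx x0 IE]]]; first by apply.
by apply/esym/cls_eq => //; exists x.
Qed.

End Ideals.

(** * Finiteness of the class group and inverses of ideals *)

(** Lagrange's argument: G is a disjoint union of cycles of f of length N.  It is
used with f the multiplication by an ideal class. *)
Lemma free_iter_card (T : pointedType) (G : set T) (h N : nat) (f : T -> T) :
  (G #= `I_h)%card -> (0 < N)%N -> (forall x, G x -> G (f x)) ->
  (forall x, G x -> iter N f x = x) ->
  (forall x k, G x -> (0 < k < N)%N -> iter k f x <> x) ->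
  (N %| h)%N.
Proof.
move=> Gh N0 fG fN fk.
have /card_set_bijP[g [gfun ginj gsurj]] : ([set: 'I_h] #= G)%card.
  exact/card_esym/(card_eq_trans Gh)/card_II.
have gG i : G (g i) by exact: gfun.
have {}ginj : injective g by move=> i j; apply: ginj; rewrite inE.
have /choice[F FE] : forall i, exists j, g j = f (g i).
  by move=> i; have [j _ jE] := gsurj _ (fG _ (gG i)); exists j.
have iterFE k i : g (iter k F i) = iter k f (g i).
  by elim: k => //= k IHk; rewrite FE IHk.
have Fperiod i : iter N F i = i by apply: ginj; rewrite iterFE fN.
have Finj : injective F.
  move=> i j /(congr1 (iter N.-1 F)); rewrite -!iterSr prednK //.
  by rewrite !Fperiod.
have orderF i : order F i = N.
  apply/eqP; rewrite eqn_leq; apply/andP; split; rewrite leqNgt; apply/negP => lt.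
    have := findex_iter lt; rewrite Fperiod.
    by rewrite (findex_iter (i := 0%N) (order_gt0 _ _)) => N00; rewrite -N00 in N0.
  apply: (fk _ (order F i) (gG i)); first by rewrite order_gt0.
  by rewrite -iterFE iter_order.
have := @fcard_order_set _ F Finj N predT.
rewrite -[#|predT|]/#|'I_h| card_ord => <- //; first exact: dvdn_mull.
by apply/fintype.subsetP => i _; rewrite inE orderF.
Qed.

(** Dirichlet's pigeonhole: two of the Q + 1 fractional parts of t b fall into the
same interval of length 1 / Q. *)
Lemma dirichlet (b : rat) (Q : nat) : (0 < Q)%N ->
  exists t : nat, exists Y : int,
    [/\ (0 < t)%N, (t <= Q)%N & `|t%:R * b - Y%:~R| < Q%:R^-1].
Proof.
move=> Q0; have Qr : 0 < Q%:R :> rat by rewrite ltr0n.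
pose fr (t : nat) : rat := t%:R * b - (Num.floor (t%:R * b))%:~R.
have fr0 t : 0 <= fr t by rewrite subr_ge0 floor_le.
have fr1 t : fr t < 1.
  by have /andP[_] := floor_itv (t%:R * b); rewrite intrD -ltrBlDl.
have boxP (t : nat) : (Num.trunc (Q%:R * fr t) < Q)%N.
  rewrite truncn_lt_nat; last by rewrite mulr_ge0 // ltW.
  by rewrite gtr_pMr.
pose box (t : 'I_Q.+1) : 'I_Q := Ordinal (boxP t).
have /injectivePn[t1 [t2 t12 boxE]] : ~~ injectiveb box.
  apply/negP => /injectiveP /leq_card; rewrite !card_ord; lia.
wlog lt12 : t1 t2 t12 boxE / (t1 < t2)%N.
  move=> H; case: (ltngtP t1 t2) => [|lt|E]; first exact: H.
    by apply: (H t2 t1) => //; rewrite eq_sym.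
  by case/eqP: t12; apply: val_inj.
exists (t2 - t1)%N, (Num.floor (t2%:R * b) - Num.floor (t1%:R * b)); split.
- by rewrite subn_gt0.
- by rewrite leq_subLR (leq_trans (leq_ord t2)) // leq_addl.
have -> : (t2 - t1)%:R * b - (Num.floor (t2%:R * b) - Num.floor (t1%:R * b))%:~R
          = fr t2 - fr t1.
  by rewrite natrB ?(ltnW lt12) // rmorphB /fr /=; ring.
rewrite -[X in _ < X]mul1r ltr_pdivlMr // -[Q%:R]gtr0_norm // -normrM.
have /(congr1 val)/= := boxE; set n := Num.trunc _ => nE.
have /andP[a1 b1] : n%:R <= Q%:R * fr t1 < n.+1%:R.
  by apply: truncn_itv; rewrite mulr_ge0 // ltW.
have /andP[a2 b2] : n%:R <= Q%:R * fr t2 < n.+1%:R.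
  by rewrite nE; apply: truncn_itv; rewrite mulr_ge0 // ltW.
rewrite -[n.+1]addn1 natrD in b1 b2.
rewrite ltr_norml; apply/andP; split; lra.
Qed.

Lemma round_half (a : rat) : exists X : int, `|a - X%:~R| <= 2^-1.
Proof.
exists (Num.floor (a + 2^-1)).
have := floor_itv (a + 2^-1); rewrite rmorphD rmorph1 /= => /andP[H1 H2].
by rewrite ler_norml; apply/andP; split; lra.
Qed.

Section ClassGroupFinite.

Context (D : int) {rqD : real_quadratic D}.

Local Notation K := (Qsqrt D).
Local Notation OK := (ring_of_integers K).
Local Notation fid := (fractional_ideal K).
Local Notation cls := (ideal_class K).
Local Notation qel := (qel D).
Local Notation nm := (nm D).
Local Notation cj := (cj D).
Local Notation Q := `|D|%N.

Let Q0 : (0 < Q)%N.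
Proof. by rewrite absz_gt0 gt_eqF // radicand_gt0. Qed.

Let DQ : D = Q :> int.
Proof. by rewrite gez0_abs // ltW // radicand_gt0. Qed.

Lemma radicand_gt1 : 1 < D.
Proof.
rewrite lt_neqAle; apply/andP; split; last by rewrite -gtz0_ge1 radicand_gt0.
by apply/eqP => D1; apply: (radicand_nonsquare (D := D)); exists 1; rewrite -D1.
Qed.

(** A substitute for Euclidean division: up to a factor t <= D, any g = a + b sqrt D
is close to an integer.  Dirichlet's theorem makes D (t b - Y)^2 < 1, and t a is
rounded to the nearest integer; the two terms of the norm have opposite signs. *)
Lemma euclid_approx g : K g -> exists t : nat, exists w,
  [/\ (0 < t)%N, (t <= Q)%N, OK w & `|nm (t%:R * g - w)| < 1].
Proof.
move=> /qelP[a [b ->]]; have [t [Y [t0 tQ tY]]] := dirichlet b Q0.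
have [X tX] := round_half (t%:R * a).
exists t, (qel X%:~R Y%:~R); split=> //; first exact: OK_qel.
have -> : t%:R * qel a b - qel X%:~R Y%:~R = qel (t%:R * a - X%:~R) (t%:R * b - Y%:~R).
  rewrite -[t%:R]/((t : int)%:~R) (qel_int D) qelM qelB.
  by congr (qel _ _); rewrite -?pmulrn; ring.
rewrite nm_qel; move: tX tY; set u := _ - _; set v := _ - _ => tX tY.
have u2 : 0 <= u ^+ 2 <= 4^-1.
  rewrite sqr_ge0 /= -real_normK ?num_real //.
  have n0 := normr_ge0 u; nra.
have v2 : 0 <= D%:~R * v ^+ 2 < 1.
  have D0 : 0 < D%:~R :> rat by rewrite ltr0z radicand_gt0.
  rewrite pmulr_rge0 // sqr_ge0 /= -real_normK ?num_real //.
  have n0 := normr_ge0 v.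
  have {tY}tY : D%:~R * `|v| < 1.
    by rewrite mulrC -ltr_pdivlMr // div1r; move: tY; rewrite {2}DQ -pmulrn.
  have D1 : 1 <= D%:~R :> rat by rewrite ler1z ltW // radicand_gt1.
  nra.
by rewrite ltr_norml; apply/andP; split; lra.
Qed.

Lemma integral_multiple I : fid I -> exists d, [/\ OK d, d != 0,
  fid [set d * x | x in I] & [set d * x | x in I] `<=` OK].
Proof.
move=> fI; have [_ _ _ _ [d [Od d0 dI]]] := fI; exists d; split=> //.
  by apply: fid_scale => //; exact: OK_K.
by move=> _ [x Ix <-]; exact: dI.
Qed.

(** Every ideal class has such a representative, and there are finitely many of
them, since they lie between OK and (1 / D!) OK. *)
Definition near_OK (J : set algC) :=
  [/\ fid J, OK `<=` J & forall x, J x -> OK ((Q`!)%:R * x)].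

(** Let b have the least nonzero norm in the integral ideal I'.  For a in I', the
combination t a - w b of [euclid_approx] has smaller norm, hence vanishes, so
t (a / b) is an integer; and t <= D divides D!. *)
Lemma reduced_ideal I : fid I -> exists2 J, near_OK J & ideal_equiv K I J.
Proof.
move=> fI; have [d [Od d0 fI' I'O]] := integral_multiple fI.
set I' := [set _ | _ in _] in fI' I'O.
pose P n := `[< exists b, [/\ I' b, b != 0 & `|nm b| = n%:R] >].
have nmP b : I' b -> exists n : nat, `|nm b| = n%:R.
  move=> /I'O /OK_nmP[n ->]; exists `|n|%N.
  by rewrite -intr_norm pmulrn abszE.
have exP : exists n, P n.
  have [_ [b I'b b0] _ _ _] := fI'; have [n nE] := nmP b I'b.
  by exists n; apply/asboolP; exists b.
case: (ex_minnP exP) => n /asboolP[b [I'b b0 nb]] nmin.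
have Kb : K b by exact: fid_K fI' _ I'b.
have key a : I' a -> exists t : nat, [/\ (0 < t)%N, (t <= Q)%N & OK (t%:R * (a / b))].
  move=> I'a; have Ka : K a by exact: fid_K fI' _ I'a.
  have [t [w [t0 tQ Ow tw]]] := euclid_approx (KM Ka (KV Kb)).
  exists t; split=> //.
  have Ot : OK t%:R by rewrite pmulrn; exact: OK_int.
  have I'c : I' (t%:R * a - w * b) by apply: (fidB fI'); exact: (fidM fI').
  have cE : t%:R * a - w * b = b * (t%:R * (a / b) - w).
    by rewrite mulrBr [w * b]mulrC; congr (_ - _); rewrite mulrCA [b * _]mulrC divfK.
  have [c0|c0] := eqVneq (t%:R * a - w * b) 0.
    move/eqP: c0; rewrite cE mulf_eq0 (negbTE b0) subr_eq0 /= => /eqP ->.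
    exact: Ow.
  have [n' n'E] := nmP _ I'c.
  have := nmin n'; rewrite leqNgt => /(_ _)/negP H; exfalso; apply: H.
    by apply/asboolP; exists (t%:R * a - w * b).
  rewrite -(ltr_nat rat) -n'E -nb cE nmM //; last first.
    apply: KB; last exact: OK_K.
    by apply: KM; [exact: OK_K|apply: KM => //; exact: KV].
  rewrite normrM gtr_pMr // normr_gt0; apply: contra_neq b0; exact: nm_eq0.
exists [set b^-1 * y | y in I'].
  have ib0 : b^-1 != 0 by rewrite invr_eq0.
  split; first by apply: fid_scale => //; exact: KV.
    move=> y Oy; exists (y * b); last by rewrite mulrC mulfK.
    exact: (fidM fI').
  move=> _ [a I'a <-]; have [t [t0 tQ Ot]] := key a I'a.
  have /dvdnP[q ->] : (t %| Q`!)%N by rewrite dvdn_fact // t0.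
  rewrite natrM -mulrA [b^-1 * a]mulrC; apply: OKM => //.
  by rewrite pmulrn; exact: OK_int.
apply: (@equiv_trans _ _ I'); last first.
  by exists b^-1; split; [exact: KV|rewrite invr_eq0|].
by exists d; split=> //; exact: OK_K.
Qed.

Let R := (2 * Q * Q`!)%N.

Let R0 : (0 < R)%N. Proof. by rewrite !muln_gt0 Q0 fact_gt0. Qed.

(** R is a common denominator for the coordinates of the elements of the ideals in
[near_OK].  As these ideals contain OK, their elements matter only up to
integers, hence only those with numerators below R. *)
Let digits (J : set algC) : {set 'I_R * 'I_R} :=
  [set ij : 'I_R * 'I_R | `[< J (R%:R^-1 * qel (ij.1 : nat)%:R (ij.2 : nat)%:R) >]]%SET.

Lemma near_OK_sub J J' : near_OK J -> near_OK J' -> digits J = digits J' -> J `<=` J'.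
Proof.
move=> [fJ OJ JO] [fJ' OJ' JO'] E x Jx.
have [X [Y xE]] := OK_coord (JO x Jx).
have RC : R%:R != 0 :> algC by rewrite pnatr_eq0 -lt0n.
have Rz : (R : int) != 0 by rewrite eqz_nat -lt0n.
have {xE}xE : x = R%:R^-1 * qel X%:~R Y%:~R.
  have RE : R%:R = (2 * D)%:~R * (Q`!)%:R :> algC.
    have DC : D%:~R = Q%:R :> algC by rewrite {1}DQ -pmulrn.
    by rewrite /R !natrM rmorphM /= DC.
  by rewrite -xE [(2 * D)%:~R * (_ * _)]mulrA -RE mulKf.
have modP (Z : int) : exists2 i : 'I_R, exists q : int, Z = q * R + i & True.
  have lt : (`|(Z %% R)%Z| < R)%N.
    by rewrite -ltz_nat gez0_abs ?modz_ge0 // ltz_pmod.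
  exists (Ordinal lt) => //; exists (Z %/ R)%Z => /=.
  by rewrite gez0_abs ?modz_ge0 //; exact: divz_eq.
have [i [q XE] _] := modP X; have [j [q' YE] _] := modP Y.
have xE' : x = qel q%:~R q'%:~R + R%:R^-1 * qel (i : nat)%:R (j : nat)%:R.
  apply: (mulfI RC); rewrite mulrDr mulVKf // xE mulVKf //.
  rewrite -[R%:R]/((R : int)%:~R) (qel_int D) qelM qelD XE YE.
  by congr (qel _ _); rewrite rmorphD rmorphM /= -!pmulrn; ring.
have Oq : OK (qel q%:~R q'%:~R) by exact: OK_qel.
have Jd : J (R%:R^-1 * qel (i : nat)%:R (j : nat)%:R).
  have -> : R%:R^-1 * qel (i : nat)%:R (j : nat)%:R = x - qel q%:~R q'%:~R.
    by rewrite xE'; ring.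
  by apply: (fidB fJ) => //; exact: OJ.
rewrite xE'; apply: (fidD fJ'); first exact: OJ'.
have : (i, j) \in digits J by rewrite inE; apply/asboolP.
by rewrite E inE => /asboolP.
Qed.

Lemma near_OK_finite : finite_set near_OK.
Proof.
pose g (s : {set 'I_R * 'I_R}) := xget set0 [set J | near_OK J /\ digits J = s].
apply: (@sub_finite_set _ _ (g @` setT)); last first.
  by apply: finite_image; exact: finite_finset.
move=> J nJ; exists (digits J) => //.
rewrite /g; case: xgetP => [J' -> [nJ' E]|/(_ J)]; last by case.
by apply/seteqP; split; exact: near_OK_sub.
Qed.

Lemma class_group_finite : finite_set (class_group K).
Proof.
apply: (@sub_finite_set _ _ (cls @` near_OK)).
  move=> _ [I fI <-]; have [J nJ IJ] := reduced_ideal fI; exists J => //.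
  by apply/esym/cls_eq => //; case: nJ.
by apply: finite_image; exact: near_OK_finite.
Qed.

(** The product of an integral ideal with its conjugate is generated by the least
positive integer c that it contains: c divides the norms and the traces
tr (x y^cj) of its elements, so each (x y^cj) / c has integral trace and norm. *)
Lemma ideal_inverse I : fid I -> exists J c,
  [/\ fid J, K c, c != 0 & ideal_mul I J = prid D c].
Proof.
move=> fI; have [d [Od d0 fI' I'O]] := integral_multiple fI.
set I' := [set _ | _ in _] in fI' I'O.
suff [J [c [fJ Kc c0 E]]] : exists J c,
    [/\ fid J, K c, c != 0 & ideal_mul I' J = prid D c].
  exists (ideal_mul (prid D d) J), c; split=> //.
    by apply: fid_mul => //; apply: fid_prid => //; exact: OK_K.
  by rewrite ideal_mulA [ideal_mul I _]ideal_mulC prid_mul.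
pose J := [set cj x | x in I'].
have fJ : fid J.
  split.
  - by move=> _ [x _ <-]; exact: K_cj.
  - have [_ [x I'x x0] _ _ _] := fI'; exists (cj x); first by exists x.
    apply: contra_neq x0 => cx0; rewrite -(cjK (fid_K fI' I'x)) cx0.
    exact: cj0.
  - move=> _ _ [x I'x <-] [y I'y <-]; exists (x - y); first exact: (fidB fI').
    by rewrite cjB //; exact: fid_K fI' _ _.
  - move=> a _ Oa [x I'x <-]; exists (cj a * x).
      by apply: (fidM fI') => //; exact: OK_cj.
    rewrite cjM ?cjK //; [exact: OK_K|exact: K_cj|exact: fid_K fI' _ _].
  exists 1; split; [exact: OK1|exact: oner_neq0|].
  by move=> _ [x I'x <-]; rewrite mul1r; apply: OK_cj; exact: I'O.
have fIJ := fid_mul fI' fJ.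
pose P n := `[< (0 < n)%N /\ ideal_mul I' J n%:R >].
have nmIJ x : I' x -> ideal_mul I' J (ratr (nm x)).
  move=> I'x; rewrite -mulr_cj; last exact: fid_K fI' _ I'x.
  by apply: mem_ideal_mul => //; exists x.
have absIJ (n : int) : ideal_mul I' J n%:~R -> ideal_mul I' J `|n|%N%:R.
  case: n => [k|k] IJn; first by [].
  by have := fidN fIJ IJn; rewrite NegzE rmorphN opprK.
have exP : exists n, P n.
  have [_ [x I'x x0] _ _ _] := fI'; have [n nE] := OK_nmP (I'O _ I'x).
  exists `|n|%N; apply/asboolP; split.
    rewrite absz_gt0; apply: contra_neq x0 => n0; apply: (@nm_eq0 D).
      exact: fid_K fI' _ I'x.
    by rewrite nE n0.
  by apply: absIJ; have := nmIJ x I'x; rewrite nE ratr_int.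
case: (ex_minnP exP) => c /asboolP[c0 IJc] cmin.
have cC : c%:R != 0 :> algC by rewrite pnatr_eq0 -lt0n.
have cdvd (n : int) : ideal_mul I' J n%:~R -> exists q : int, n = q * c.
  move=> IJn; exists (n %/ c)%Z; rewrite {1}(divz_eq n c).
  set r := (n %% c)%Z; have r0 : 0 <= r by rewrite modz_ge0 // eqz_nat -lt0n.
  have rc : r < c by rewrite ltz_pmod.
  have IJr : ideal_mul I' J r%:~R.
    have -> : r = n - (n %/ c)%Z * c by apply/eqP; rewrite eq_sym subr_eq addrC -divz_eq.
    rewrite rmorphB rmorphM /=; apply: (fidB fIJ) => //.
    by apply: (fidM fIJ) => //; exact: OK_int.
  suff -> : r = 0 by rewrite addr0.
  apply/eqP/negP => /negP r_neq0; have := cmin `|r|%N.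
  rewrite leqNgt => /(_ _)/negP; apply.
    by apply/asboolP; split; [rewrite absz_gt0|exact: absIJ].
  by rewrite -ltz_nat gez0_abs.
exists J, c%:R; split=> //; first exact: (K_int D c).
apply/seteqP; split; last first.
  by move=> _ [a Oa <-]; rewrite mulrC; exact: (fidM fIJ).
apply: ideal_mul_sub.
- by exists 0; rewrite ?mulr0 //; exact: OK0.
- by move=> _ _ [a Oa <-] [b Ob <-]; exists (a + b); rewrite ?mulrDr //; exact: OKD.
move=> x _ I'x [y I'y <-].
have Kx := fid_K fI' I'x; have Ky := fid_K fI' I'y; have Kcy := K_cj D y.
have Kxy : K (x * cj y) by exact: KM.
exists (x * cj y / c%:R); last by rewrite mulrC divfK.
have [nx nxE] := OK_nmP (I'O _ I'x); have [ny nyE] := OK_nmP (I'O _ I'y).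
have [qx qxE] : exists q : int, nx = q * c.
  by apply: cdvd; have := nmIJ x I'x; rewrite nxE ratr_int.
have [qy qyE] : exists q : int, ny = q * c.
  by apply: cdvd; have := nmIJ y I'y; rewrite nyE ratr_int.
have [t tE] := OK_trP (OKM (I'O _ I'x) (OK_cj (I'O _ I'y))).
have [q qE] : exists q : int, t = q * c.
  apply: cdvd; have -> : t%:~R = x * cj y + y * cj x :> algC.
    rewrite -ratr_int -tE -addr_cj // cjM // cjK //.
    by congr (_ + _); exact: mulrC.
  by apply: (fidD fIJ); apply: mem_ideal_mul => //; [exists y|exists x].
have Kc : K (c%:R^-1) by apply: KV; exact: (K_int D c).
have Kz : K (x * cj y / c%:R) by exact: KM.
have cR : c%:R != 0 :> rat by rewrite pnatr_eq0 -lt0n.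
have zE : x * cj y = c%:R * (x * cj y / c%:R) by rewrite [RHS]mulrC divfK.
apply: (@OK_tr_nm D _ _ q (qx * qy)) => //.
- apply: (fmorph_inj (@ratr algC)); apply: (mulfI cC); rewrite /=.
  have <- : ratr (tr D (x * cj y)) = c%:R * ratr (tr D (x * cj y / c%:R)) :> algC.
    rewrite -!addr_cj // [c%:R * (_ + _)]mulrDr -zE; congr (_ + _).
    by rewrite {1}zE cjM //; [congr (_ * _); exact: (cj_int c)|exact: (K_int D c)].
  by rewrite tE qE !ratr_int rmorphM /= mulrC.
apply: (@mulfI _ (c%:R ^+ 2)); first by rewrite expf_neq0.
rewrite -[c%:R]/((c : int)%:~R) -(nm_int c) -nmM //; last exact: K_int.
rewrite -[(c : int)%:~R]/(c%:R) -zE nmM // nm_cj // nxE nyE qxE qyE (nm_int c).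
by rewrite !rmorphM /=; ring.
Qed.

End ClassGroupFinite.

(** * The ideal attached to a norm equation *)

Section ClassOrder.

Context (D : int) {rqD : real_quadratic D}.

Local Notation K := (Qsqrt D).
Local Notation OK := (ring_of_integers K).
Local Notation fid := (fractional_ideal K).
Local Notation cls := (ideal_class K).

Definition principal (I : set algC) := exists x, [/\ K x, x != 0 & I = prid D x].

Lemma class_number_exists : exists h, class_number_is K h.
Proof. exact/finite_setP/class_group_finite. Qed.

Lemma has_order_ipow I n : fid I -> (0 < n)%N -> principal (ipow D I n) ->
  (forall k, (0 < k < n)%N -> ~ principal (ipow D I k)) ->
  class_has_order K (cls I) n.
Proof.
move=> fI n0 pn npk; split=> //; first by rewrite cls_expE //; apply/cls_one_eq => //; exact: fid_ipow.
move=> k kn; rewrite cls_expE // => /cls_one_eq H; apply: (npk k kn).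
by apply: H; exact: fid_ipow.
Qed.

(** Multiplication by the class of I acts on the class group; a cycle shorter than
n would, after cancelling an ideal J by [ideal_inverse], give a smaller power
of I that is principal. *)
Lemma order_dvd_class_number I n h : fid I -> class_has_order K (cls I) n ->
  class_number_is K h -> (n %| h)%N.
Proof.
move=> fI [n0 In1 Ik] hP.
have iterE k J : fid J ->
    iter k (class_mul K (cls I)) (cls J) = cls (ideal_mul (ipow D I k) J).
  move=> fJ; elim: k => [|k IHk]; first by rewrite /= OK_mul.
  rewrite iterS IHk cls_mulE //; last by apply: fid_mul => //; exact: fid_ipow.
  by rewrite ideal_mulA.
apply: (@free_iter_card _ (class_group K) h n (class_mul K (cls I))) => //.
- by move=> _ [J fJ <-]; rewrite cls_mulE //; exists (ideal_mul I J) => //; exact: fid_mul.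
- move=> _ [J fJ <-]; rewrite iterE // -cls_mulE //; last exact: fid_ipow.
  rewrite -cls_expE // In1 cls_mulE //; last exact: fid_OK.
  by rewrite OK_mul.
move=> _ k [J fJ <-] kn; rewrite iterE // => /cls_eq => /(_ fJ)/equivE.
have fIk : fid (ipow D I k) by exact: fid_ipow.
have fIkJ := fid_mul fIk fJ.
move=> /(_ fIkJ)[x [Kx x0 JE]]; apply: (Ik k kn); rewrite cls_expE //.
apply/cls_one_eq => //; exists x^-1; split; [exact: KV|by rewrite invr_eq0|].
have [J' [c [fJ' Kc c0 JJ']]] := ideal_inverse fJ.
have Kxi : K x^-1 by exact: KV.
have xi0 : x^-1 != 0 by rewrite invr_eq0.
have E : prid D c = ideal_mul (prid D x) (ideal_mul (prid D c) (ipow D I k)).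
  rewrite -{1}JJ' {1}JE -JJ' -[in RHS]ideal_mulA [ideal_mul J' _]ideal_mulC.
  by rewrite !ideal_mulA [ideal_mul (ideal_mul (prid D x) J) _]ideal_mulC
             !ideal_mulA [ideal_mul _ (prid D x)]ideal_mulC.
apply: (@ideal_mul_prid_inj D (c * x)) => //.
- exact: KM.
- by rewrite mulf_neq0.
- exact: fid_prid.
rewrite [RHS]prid_mul_prid // mulfK // mulrC -prid_mul_prid // -ideal_mulA.
by rewrite -E.
Qed.

Lemma has_order_class_number I n : fid I -> class_has_order K (cls I) n ->
  class_number_divisible_by K n /\ class_group_has_element_of_order K n.
Proof.
move=> fI oI; split; last by exists (cls I) => //; exists I.
have [h hP] := class_number_exists; exists h => //.
exact: (order_dvd_class_number fI oI hP).
Qed.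

Lemma element_of_order_dvd n d : (d %| n)%N ->
  class_group_has_element_of_order K n -> class_group_has_element_of_order K d.
Proof.
move=> /dvdnP[q nE] [_ [I fI <-] [n0 In Ik]].
have [q0 d0] : (0 < q)%N /\ (0 < d)%N by move: n0; rewrite nE muln_gt0 => /andP.
have fJ := fid_ipow q fI.
have expE k : class_exp K (cls (ipow D I q)) k = class_exp K (cls I) (q * k).
  by rewrite !cls_expE // ipowM.
exists (cls (ipow D I q)); first by exists (ipow D I q).
split=> //; first by rewrite expE -nE.
by move=> k /andP[k0 kd]; rewrite expE; apply: Ik; rewrite muln_gt0 q0 k0 nE ltn_pmul2l.
Qed.

End ClassOrder.

Section CertificateIdeal.

Context (D : int) {rqD : real_quadratic D}.

Local Notation K := (Qsqrt D).
Local Notation OK := (ring_of_integers K).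
Local Notation fid := (fractional_ideal K).
Local Notation cj := (cj D).

Variables (N : nat) (z : int).
Hypothesis N_gt0 : (0 < N)%N.
Hypothesis z_neq0 : z != 0.

Definition ideal_gen2 (b a : algC) : set algC :=
  [set y | exists u v, [/\ OK u, OK v & y = b * u + a * v]].

Lemma gen2_l b a : ideal_gen2 b a b.
Proof. by exists 1, 0; split; [exact: OK1|exact: OK0|rewrite mulr1 mulr0 addr0]. Qed.

Lemma gen2_r b a : ideal_gen2 b a a.
Proof. by exists 0, 1; split; [exact: OK0|exact: OK1|rewrite mulr1 mulr0 add0r]. Qed.

Lemma fid_gen2 b a : OK b -> b != 0 -> OK a -> fid (ideal_gen2 b a).
Proof.
move=> Ob b0 Oa.
have sub : ideal_gen2 b a `<=` OK by move=> _ [u [v [Ou Ov ->]]]; apply: OKD; exact: OKM.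
split.
- by move=> y /sub; exact: OK_K.
- by exists b => //; exact: gen2_l.
- move=> _ _ [u [v [Ou Ov ->]]] [u' [v' [Ou' Ov' ->]]].
  by exists (u - u'), (v - v'); split; [exact: OKB|exact: OKB|ring].
- move=> c _ Oc [u [v [Ou Ov ->]]].
  by exists (c * u), (c * v); split; [exact: OKM|exact: OKM|ring].
by exists 1; split; [exact: OK1|exact: oner_neq0|move=> y /sub; rewrite mul1r].
Qed.

Lemma ipow_gen2_sub b a k : OK b -> b != 0 -> OK a ->
  ipow D (ideal_gen2 b a) k `<=` ideal_gen2 (b ^+ k) a.
Proof.
move=> Ob b0 Oa; elim: k => [|k IHk] /=.
  move=> y Oy; exists y, 0; split => //; [exact: OK0|].
  by rewrite expr0 mul1r mulr0 addr0.
rewrite -/(ipow D _ _).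
have fk : fid (ideal_gen2 (b ^+ k.+1) a).
  by apply: fid_gen2 => //; [exact: OKX|rewrite expf_neq0].
apply: ideal_mul_sub => [|y y'|_ y [u [v [Ou Ov ->]]] /IHk[u' [v' [Ou' Ov' ->]]]].
- exact: (fid0 fk).
- exact: (fidD fk).
exists (u * u'), (v * (b ^+ k * u') + a * (v * v') + b * u * v'); split.
- exact: OKM.
- by apply: OKD; [apply: OKD|]; do ?apply: OKM; rewrite //; exact: OKX.
by rewrite exprS; ring.
Qed.

Variable al : algC.
Hypothesis Oal : OK al.
Hypothesis al_nm : al * cj al = z%:~R ^+ N.
Variable t : int.
Hypothesis al_tr : al + cj al = t%:~R.
Hypothesis zt : coprimez t z.

Let zC : z%:~R != 0 :> algC. Proof. by rewrite intr_eq0. Qed.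
Let Oz : OK z%:~R. Proof. exact: OK_int. Qed.
Let Ocal : OK (cj al). Proof. exact: OK_cj. Qed.

Lemma al_cj_neq0 : al != 0 /\ cj al != 0.
Proof.
have : al * cj al != 0 by rewrite al_nm expf_neq0.
by rewrite mulf_eq0 negb_or => /andP.
Qed.

(** The product is generated by z^2, z al, z cj(al) and z^N; dividing by z, the
integers z and t = al + cj(al) are coprime. *)
Lemma gen2_mul_conj :
  ideal_mul (ideal_gen2 z%:~R al) (ideal_gen2 z%:~R (cj al)) = prid D z%:~R.
Proof.
have fa : fid (ideal_gen2 z%:~R al) by exact: fid_gen2.
have fb : fid (ideal_gen2 z%:~R (cj al)) by exact: fid_gen2.
have fab := fid_mul fa fb.
have fz : fid (prid D z%:~R) by apply: fid_prid => //; exact: K_int.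
apply/seteqP; split.
  apply: ideal_mul_sub => [|y y'|_ _ [u [v [Ou Ov ->]]] [u' [v' [Ou' Ov' ->]]]].
  - exact: (fid0 fz).
  - exact: (fidD fz).
  exists (z%:~R * (u * u') + al * (v * u') + cj al * (u * v') + z%:~R ^+ N.-1 * (v * v')).
    by do ?apply: OKD; do ?apply: OKM; rewrite //; exact: OKX.
  transitivity (z%:~R * (z%:~R * (u * u') + al * (v * u') + cj al * (u * v'))
                + z%:~R ^+ N * (v * v')); last by rewrite -al_nm; ring.
  by rewrite -(prednK N_gt0) exprS /=; ring.
move=> _ [y Oy <-]; rewrite mulrC; apply: (fidM fab) => //.
have /coprimezP[[p q] /= pq] := zt.
have zE : z%:~R = p%:~R * (z%:~R * cj al + al * z%:~R) + q%:~R * (z%:~R * z%:~R) :> algC.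
  have : (p * t + q * z)%:~R = 1 :> algC by rewrite pq.
  rewrite rmorphD !rmorphM /= -al_tr => pq1.
  transitivity (z%:~R * (p%:~R * (al + cj al) + q%:~R * z%:~R)); last by ring.
  by rewrite pq1 mulr1.
rewrite [X in ideal_mul _ _ X]zE; apply: (fidD fab); apply: (fidM fab);
  rewrite ?OK_int; do ?exact: OK_int.
  apply: (fidD fab); apply: mem_ideal_mul; do ?[exact: gen2_l|exact: gen2_r].
by apply: mem_ideal_mul; exact: gen2_l.
Qed.

(** One has (z, al)^N in (z^N, al), which is contained in (al) because
z^N = al cj(al), and likewise for the conjugate.  The product of both sides is
(z)^N = (al cj(al)), so the inclusions are equalities. *)
Lemma gen2_pow : ipow D (ideal_gen2 z%:~R al) N = prid D al.
Proof.
have [al0 cal0] := al_cj_neq0.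
have fa : fid (ideal_gen2 z%:~R al) by exact: fid_gen2.
have fb : fid (ideal_gen2 z%:~R (cj al)) by exact: fid_gen2.
have sub a' : OK a' -> cj a' * a' = z%:~R ^+ N -> OK (cj a') ->
    ipow D (ideal_gen2 z%:~R a') N `<=` prid D a'.
  move=> Oa' nmE Oca' y /ipow_gen2_sub; move=> /(_ Oz zC Oa')[u [v [Ou Ov ->]]].
  exists (cj a' * u + v); first by apply: OKD => //; exact: OKM.
  by rewrite -nmE [LHS]mulrDr mulrA [a' * cj a']mulrC.
apply/seteqP; split; first by apply: sub => //; rewrite mulrC.
have E : ideal_mul (ipow D (ideal_gen2 z%:~R al) N) (ipow D (ideal_gen2 z%:~R (cj al)) N)
         = prid D (al * cj al).
  rewrite -ipow_mul // gen2_mul_conj ipow_prid // ?al_nm //; exact: K_int.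
have H : ideal_mul (prid D (cj al)) (ipow D (ideal_gen2 z%:~R al) N) (al * cj al).
  rewrite ideal_mulC.
  apply: (@ideal_mulS (ipow D (ideal_gen2 z%:~R al) N) (ipow D (ideal_gen2 z%:~R (cj al)) N)).
  - by [].
  - by apply: sub => //; rewrite cjK //; exact: OK_K.
  by rewrite E; exact: mem_prid.
move: H; rewrite prid_mul; last exact: fid_ipow.
move=> [y Iy yE]; have alE : y = al by apply: (mulfI cal0); rewrite yE mulrC.
move=> _ [u Ou <-]; rewrite mulrC; apply: (fidM (fid_ipow N fa)) => //.
by rewrite -[X in ipow _ _ _ X]alE.
Qed.

End CertificateIdeal.

Theorem certificate_class_group N D x y z A B k :
  certificate N D x y z A B k -> (1 < N)%N ->
  class_number_divisible_by (Qsqrt D) N /\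
  class_group_has_element_of_order (Qsqrt D) N.
Proof.
move=> c N1; have rqD := cert_real c; have N0 : (0 < N)%N by exact: ltnW.
have z0 : z != 0.
  apply/eqP => z0; have := cert_coprime c; rewrite z0 /coprimez gcdz0 abszM.
  by rewrite eqz_nat muln_eq1.
set K := Qsqrt D.
pose al := cert_alpha D x y; have Oal : ring_of_integers K al by exact: OK_alpha c.
have Kal : K al by exact: OK_K.
have nmE : al * cj D al = z%:~R ^+ N.
  have zE : (z%:~R : rat) ^+ N = x%:~R ^+ 2 - D%:~R * y%:~R ^+ 2.
    by rewrite -rmorphXn /= -(cert_norm c) intrB intrM !rmorphXn.
  by rewrite mulr_cj // nm_qel -zE rmorphXn /= ratr_int.
have trE : al + cj D al = (2 * x)%:~R.
  by rewrite addr_cj // tr_qel -[RHS]ratr_int intrM.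
have zt := cert_coprime c.
have aN : ipow D (ideal_gen2 D z%:~R al) N = prid D al.
  by apply (gen2_pow N0 z0 Oal nmE trE zt).
have [al0 _] := al_cj_neq0 z0 nmE.
set a := ideal_gen2 D z%:~R al in aN.
have fa : fractional_ideal K a.
  by apply: fid_gen2; rewrite ?intr_eq0 //; exact: OK_int.
apply: (has_order_class_number fa); apply: (has_order_ipow fa N0).
  by exists al; split.
move=> j jN [be [Kbe be0 ajE]].
have E : prid D (al ^+ j) = prid D (be ^+ N).
  rewrite -!ipow_prid // -ajE -aN -!ipowM // mulnC //.
have [u Ou uE] : prid D (be ^+ N) (al ^+ j) by rewrite -E; exact: mem_prid.
have [u' Ou' u'E] : prid D (al ^+ j) (be ^+ N) by rewrite E; exact: mem_prid.
have uu' : u * u' = 1.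
  apply: (@mulfI _ (be ^+ N)); first by rewrite expf_neq0.
  by rewrite mulrA uE u'E mulr1.
have u0 : u != 0 by apply: contra_eq_neq uu' => ->; rewrite mul0r eq_sym oner_eq0.
have Uu : OK_unit D u.
  by split=> //; have -> : u^-1 = u' by apply: (mulfI u0); rewrite divff.
apply: (alpha_power_not_principal c jN al0 Kbe Uu).
by rewrite -/al -uE mulrC.
Qed.

(** * Primes congruent to 1 modulo n, and squares modulo them *)

Lemma Fp_int_eq0 (l : nat) (x : int) : prime l -> ((x%:~R : 'F_l) == 0) = (l %| `|x|)%N.
Proof.
move=> pl; rewrite (dvdn_pcharf (pchar_Fp pl)) /=.
case: x => n; first by rewrite -pmulrn.
by rewrite NegzE rmorphN oppr_eq0 abszN.
Qed.

Lemma Fp_expn_pred (l : nat) (x : 'F_l) : prime l -> x != 0 -> x ^+ l.-1 = 1.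
Proof.
move=> pl x0; apply: (mulfI x0); rewrite -exprS prednK ?prime_gt0 // mulr1.
by have := expf_card x; rewrite card_Fp.
Qed.

(** Each factor X - zeta of the cyclotomic value has absolute value >= X - 1. *)
Lemma Cyclotomic_gt1 (n : nat) (X : nat) : (0 < n)%N -> (2 < X)%N ->
  (1 < `|('Phi_n).[X%:Z]|)%N.
Proof.
move=> n0 X2; have [w w_prim] := C_prim_root_exists n0.
rewrite -(ltr_nat algC); set v := _.[_].
have -> : `|v|%N%:R = `|v%:~R| :> algC by rewrite -intr_norm -abszE.
rewrite /v -horner_map /= (Cintr_Cyclotomic w_prim) /cyclotomic horner_prod.
rewrite normr_prod.
have w1 k : `|w ^+ k| = 1 :> algC.
  apply/eqP; rewrite normrX -(eqrXn2 n0) ?exprn_ge0 // expr1n -exprM mulnC exprM.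
  by rewrite -normrX (prim_expr_order w_prim) normr1 expr1n.
have le2 k : 2 <= `|('X - (w ^+ k)%:P).[(X%:Z)%:~R]| :> algC.
  rewrite !hornerE; apply: le_trans (lerB_dist _ _).
  rewrite w1 -pmulrn normr_nat lerBrDr -(natrD _ 2 1) ler_nat //.
have [k0 k0P] : exists k : 'I_n, coprime k n.
  have lt : (1 %% n < n)%N by rewrite ltn_mod.
  by exists (Ordinal lt); rewrite /= coprime_modl coprime1n.
rewrite (bigD1 k0) //=; apply: (@lt_le_trans _ _ 2); first by rewrite ltr1n.
rewrite -[2]mulr1; apply: ler_pM; rewrite ?ler0n ?ler01 //.
apply: (big_ind (fun y => 1 <= y)) => [//|y y' y1 y'1|k _].
  by rewrite -[1]mulr1; apply: ler_pM; rewrite ?ler01.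
by apply: le_trans (le2 k); rewrite ler1n.
Qed.

(** If the order d of x were smaller than n, then x would be a root of both Phi_n
and Phi_e for a divisor e of d, hence a double root of X^n - 1, which is
separable. *)
Lemma root_Cyclotomic_prim (F : fieldType) (n : nat) (x : F) :
  (0 < n)%N -> n%:R != 0 :> F -> (map_poly intr 'Phi_n).[x] = 0 ->
  n.-primitive_root x.
Proof.
move=> n0 nF x0.
have prodE d : (0 < d)%N ->
    \prod_(e <- divisors d) (map_poly intr 'Phi_e).[x] = x ^+ d - 1.
  move=> d0; rewrite -horner_prod -rmorph_prod /= prod_Cyclotomic //.
  by rewrite rmorphB rmorphXn /= map_polyX rmorph1 !hornerE.
have nn : n \in divisors n by rewrite -dvdn_divisors.
have xn1 : x ^+ n = 1.
  apply/eqP; rewrite -subr_eq0 -prodE // (big_rem n) //= x0 mul0r //.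
have [d d_prim dn] := prim_order_exists n0 xn1.
have d0 := prim_order_gt0 d_prim.
suff -> : n = d by [].
apply/eqP; rewrite eqn_leq (dvdn_leq n0 dn) andbT leqNgt; apply/negP => ltdn.
have : \prod_(e <- divisors d) (map_poly intr 'Phi_e).[x] == 0.
  by rewrite prodE // prim_expr_order // subrr.
rewrite prodf_seq_eq0 => /hasP[e]; rewrite -dvdn_divisors // => ed /= /eqP e0.
have en : e \in divisors n by rewrite -dvdn_divisors // (dvdn_trans ed).
have e_neq_n : e != n by rewrite neq_ltn (leq_ltn_trans (dvdn_leq d0 ed)).
have /(congr1 (fun P : {poly int} => ((map_poly intr P)^`()).[x])) := prod_Cyclotomic n0.
rewrite (big_rem n) //= (big_rem e) /=; last first.
  by rewrite mem_rem_uniq ?divisors_uniq // inE e_neq_n en.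
rewrite rmorphM rmorphM /= !derivM !hornerE x0 e0 !(mul0r, mulr0, addr0, add0r).
rewrite rmorphB rmorphXn /= map_polyX rmorph1 derivB derivXn derivC subr0.
rewrite hornerMn hornerXn mulr0 mul0r => /esym/eqP; rewrite -mulr_natr mulf_eq0 (negbTE nF) orbF.
rewrite expf_eq0 => /andP[_ /eqP xz]; move/eqP: xn1.
by rewrite xz expr0n eqn0Ngt n0 eq_sym oner_eq0.
Qed.

(** Euclid's argument with cyclotomic values: a prime factor l of Phi_n(X), for X
a multiple of n and of B!, exceeds B and does not divide n, so X has order n
modulo l. *)
Lemma prime_1_mod (n B : nat) : (0 < n)%N ->
  exists l, [/\ prime l, (B < l)%N & (n %| l.-1)%N].
Proof.
move=> n0; pose X := (3 * n * B`!)%N.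
have X2 : (2 < X)%N.
  by rewrite /X -mulnA (leq_trans _ (leq_mul (leqnn 3) (_ : 1 <= _)%N)) // muln_gt0 n0 fact_gt0.
have v1 := Cyclotomic_gt1 n0 X2; set v := _.[_] in v1.
pose l := pdiv `|v|; have pl : prime l by exact: pdiv_prime.
pose x : 'F_l := X%:R.
have x0 : (map_poly intr 'Phi_n).[x] = 0.
  have -> : x = (X%:Z)%:~R by rewrite -pmulrn.
  by rewrite horner_map /=; apply/eqP; rewrite Fp_int_eq0 // pdiv_dvd.
have xn1 : x ^+ n = 1.
  apply/eqP; rewrite -subr_eq0.
  have := prod_Cyclotomic n0; rewrite (big_rem n) -?dvdn_divisors //=.
  move=> /(congr1 (fun P : {poly int} => (map_poly intr P).[x])).
  rewrite rmorphM hornerM x0 mul0r rmorphB rmorphXn /= map_polyX rmorph1 !hornerE.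
  by move=> <-.
have xF : x != 0.
  by apply: contra_eq_neq xn1 => ->; rewrite expr0n eqn0Ngt n0 eq_sym oner_eq0.
have nlX : ~~ (l %| X)%N by rewrite (dvdn_pcharf (pchar_Fp pl)).
exists l; split=> //.
  rewrite ltnNge; apply: contra nlX => lB.
  by rewrite /X dvdn_mull // dvdn_fact // prime_gt0.
have nF : n%:R != 0 :> 'F_l.
  by rewrite -(dvdn_pcharf (pchar_Fp pl)); apply: contra nlX => ln;
     rewrite /X dvdn_mulr // dvdn_mull.
by rewrite (prim_order_dvd (root_Cyclotomic_prim n0 nF x0)) Fp_expn_pred.
Qed.

Lemma primes_1_mod (n B c : nat) : (0 < n)%N -> exists ls : seq nat,
  [/\ size ls = c, uniq ls & forall l, l \in ls -> [/\ prime l, (B < l)%N & (n %| l.-1)%N]].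
Proof.
move=> n0; elim: c => [|c [ls [<- uls lsP]]]; first by exists [::].
have [l [pl Bl nl]] := prime_1_mod (\max_(i <- ls) i + B)%N n0.
exists (l :: ls); split=> //=.
  rewrite uls andbT; apply/negP => lls.
  have : (l <= \max_(i <- ls) i)%N by apply: (leq_bigmax_seq (F := id)).
  by lia.
move=> q; rewrite inE => /predU1P[->|/lsP//]; split=> //.
by apply: leq_ltn_trans Bl; exact: leq_addl.
Qed.

Lemma prim_root_neq0 (F : fieldType) (n : nat) (g : F) : n.-primitive_root g -> g != 0.
Proof.
move=> gP; have := prim_expr_order gP; apply: contra_eq_neq => ->.
by rewrite expr0n eqn0Ngt (prim_order_gt0 gP) eq_sym oner_eq0.
Qed.

Lemma Fp_primitive_root (l : nat) : prime l -> exists g : 'F_l, l.-1.-primitive_root g.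
Proof.
move=> pl; have l1 : (0 < l.-1)%N by have := prime_gt1 pl; lia.
pose rs := [seq x <- enum 'F_l | x != 0].
have /hasP[g _ gP] : has l.-1.-primitive_root rs.
  apply: has_prim_root => //.
  - apply/allP => x; rewrite mem_filter => /andP[x0 _].
    by apply/unity_rootP; exact: Fp_expn_pred.
  - by rewrite filter_uniq // enum_uniq.
  rewrite size_filter.
  have := count_predC (pred1 (0 : 'F_l)) (enum 'F_l).
  rewrite -cardE (card_Fp pl) count_uniq_mem ?enum_uniq // mem_enum inE add1n.
  rewrite (eq_count (a2 := predC (pred1 (0 : 'F_l)))) //.
  by set cnt := count _ _; lia.
by exists g.
Qed.

Lemma prim_root_notpower (F : fieldType) (n p : nat) (g t : F) :
  n.-primitive_root g -> (forall x : F, x != 0 -> x ^+ n = 1) ->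
  prime p -> (p %| n)%N -> t ^+ p <> g.
Proof.
move=> gP fermat pp /dvdnP[q nE] tg.
have g0 : g != 0 by exact: prim_root_neq0 gP.
have n0 := prim_order_gt0 gP.
have t0 : t != 0.
  by apply: contra_neq g0 => t0; rewrite -tg t0 expr0n gtn_eqF ?prime_gt0.
have : g ^+ q == 1 by rewrite -tg -exprM mulnC -nE fermat.
rewrite -(prim_order_dvd gP) nE => /dvdn_leq.
have q0 : (0 < q)%N by move: n0; rewrite nE; case: (q).
move=> /(_ q0); rewrite leqNgt => /negP; apply.
by rewrite ltn_Pmulr // prime_gt1.
Qed.

Lemma prim_root_sqrt_m1 (F : fieldType) (m : nat) (w : F) : (0 < m)%N ->
  (8 * m).-primitive_root w -> [/\ w ^+ (4 * m) = -1, 2 != 0 :> F & w != 0].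
Proof.
move=> m0 wP; have w0 : w != 0 by exact: prim_root_neq0 wP.
have w8 : (w ^+ (4 * m)) ^+ 2 = 1.
  rewrite -exprM (_ : 4 * m * 2 = 8 * m)%N; last by lia.
  exact: prim_expr_order.
have w4 : w ^+ (4 * m) != 1.
  rewrite -(prim_order_dvd wP); apply/negP => dv.
  have : (8 * m <= 4 * m)%N by apply: dvdn_leq dv; lia.
  by lia.
have wE : w ^+ (4 * m) = -1.
  have /eqP : (w ^+ (4 * m) - 1) * (w ^+ (4 * m) + 1) = 0.
    by rewrite -subr_sqr w8 expr1n subrr.
  by rewrite mulf_eq0 subr_eq0 (negbTE w4) addr_eq0 => /eqP.
split=> //; apply: contra_neq w4 => F2; rewrite wE.
by apply/eqP; rewrite eq_sym -subr_eq0 opprK; rewrite -F2; apply/eqP; ring.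
Qed.

(** Evaluate (X^n - 1) / (X - 1) at 1. *)
Lemma prod_one_sub_prim_root (F : fieldType) (n : nat) (z : F) : 
  n.-primitive_root z -> \prod_(1 <= i < n) (1 - z ^+ i) = n%:R.
Proof.
move=> zP; have n0 := prim_order_gt0 zP.
have := factor_Xn_sub_1 zP; rewrite big_ltn // expr0 subrX1.
have X10 : ('X - 1%:P : {poly F}) != 0 by rewrite polyXsubC_eq0.
move=> /(mulfI X10)/(congr1 (fun P : {poly F} => P.[1])).
rewrite horner_prod horner_sum.
under eq_bigr do rewrite !hornerE.
by move=> ->; under eq_bigr do rewrite hornerXn expr1n; rewrite sumr_const card_ord.
Qed.

(** With z = w^2 of order 4 m, the product of the 1 - z^i over 0 < i < 4 m is 4 m;
the factors for i and 4 m - i agree up to a square, and the factor for i = 2 m is 2.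
Hence 4 m is 2 times a square, and 2 is a square since there are eighth roots of
unity. *)
Lemma square_of_prim_root (F : fieldType) (m : nat) (w : F) : (0 < m)%N ->
  (8 * m).-primitive_root w -> exists t : F, t ^+ 2 = m%:R.
Proof.
move=> m0 wP; have [w4 F2 w0] := prim_root_sqrt_m1 m0 wP.
have zP : (4 * m).-primitive_root (w ^+ 2).
  have := @exp_prim_root _ _ _ wP 2.
  have m8 : (8 * m = 4 * m * 2)%N by lia.
  have -> : gcdn 2 (8 * m) = 2%N by apply/gcdn_idPl; rewrite m8 dvdn_mull.
  by rewrite m8 mulnK.
have [z zE] : exists z, z = w ^+ 2 by exists (w ^+ 2).
rewrite -zE in zP.
have z0 : z != 0 by rewrite zE expf_neq0.
have prodE := prod_one_sub_prim_root zP.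
have zh : z ^+ (2 * m) = -1.
  by rewrite zE -exprM -w4; congr (_ ^+ _); lia.
have z4 : z ^+ (4 * m) = 1 by exact: prim_expr_order.
pose P : F := \prod_(1 <= i < 2 * m) (w ^+ (2 * m) * w ^- i * (1 - z ^+ i)).
have P2 : P ^+ 2 = \prod_(1 <= i < 2 * m) ((1 - z ^+ i) * (1 - z ^+ (4 * m - i))).
  rewrite /P -prodrXl; apply: eq_big_nat => i /andP[i1 i2].
  rewrite !exprMn -exprM; have -> : (2 * m * 2 = 4 * m)%N by lia.
  rewrite w4; have -> : z ^+ (4 * m - i) = (z ^+ i)^-1.
    apply: (@mulfI _ (z ^+ i)); first by rewrite !expf_neq0.
    by rewrite -exprD subnKC ?z4 ?divff ?expf_neq0 //; lia.
  rewrite exprVn -exprM mulnC exprM -zE.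
  have zi0 : z ^+ i != 0 by rewrite !expf_neq0.
  by field.
have {prodE}prodE : (4 * m)%:R = 2 * P ^+ 2 :> F.
  rewrite -prodE P2 big_split /=.
  rewrite (@big_cat_nat _ _ _ (2 * m)) /=; [|lia|lia].
  rewrite [X in _ * X = _]big_ltn ?zh; last lia.
  have -> : \prod_((2 * m).+1 <= i < 4 * m) (1 - z ^+ i)
            = \prod_(1 <= i < 2 * m) (1 - z ^+ (4 * m - i)).
    rewrite [LHS]big_nat_rev /=.
    have -> : ((2 * m).+1 = 1 + 2 * m)%N by lia.
    rewrite big_addn; have -> : (4 * m - 2 * m = 2 * m)%N by lia.
    by apply: eq_big_nat => i /andP[i1 i2]; congr (1 - _ ^+ _); lia.
  by ring.
pose e := w ^+ m.
have e4 : e ^+ 4 = -1 by rewrite /e -exprM mulnC.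
exists (e ^+ 3 * (1 + e ^+ 2) * P / 2).
have F4 : 4%:R != 0 :> F by rewrite (natrM _ 2 2) mulf_neq0.
have mE : m%:R = 2 * P ^+ 2 / 4 :> F.
  by rewrite -prodE natrM mulrC mulKf.
rewrite mE.
have -> : (e ^+ 3 * (1 + e ^+ 2) * P / 2) ^+ 2 =
   (e ^+ 4 * (e ^+ 2 + 2 * e ^+ 4 + e ^+ 4 * e ^+ 2)) * P ^+ 2 / 4.
  by field; rewrite ?F2 ?F4.
by rewrite e4; field; rewrite ?F2 ?F4.
Qed.

(** * A family of certificates *)

(** No two positive squares differ by 1. *)
Lemma sqr_pred_nonsquare (w : int) : w != 0 ->
  0 < (8 * w) ^+ 2 - 1 /\ ~ perfect_square ((8 * w) ^+ 2 - 1).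
Proof.
move=> w0.
have w_ge1 : 1 <= `|w| by rewrite -gtz0_ge1 normr_gt0.
have w2 : w ^+ 2 = `|w| ^+ 2 by rewrite real_normK ?num_real.
rewrite exprMn w2; split.
  have : 1 <= `|w| ^+ 2 by exact: exprn_ege1.
  by move: (`|w| ^+ 2) => b; lia.
move=> [n nE].
have n2 : n ^+ 2 = `|n| ^+ 2 by rewrite real_normK ?num_real.
have n_ge0 := normr_ge0 n.
have E : (8 * `|w| - `|n|) * (8 * `|w| + `|n|) = 1.
  by transitivity (8 ^+ 2 * `|w| ^+ 2 - `|n| ^+ 2); [ring|rewrite -n2 -nE; ring].
have b1 : 1 < 8 * `|w| + `|n| by lia.
have /orP[le0|ge1] : (8 * `|w| - `|n| <= 0) || (1 <= 8 * `|w| - `|n|) by lia.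
  have := mulr_le0_ge0 le0 (ltW (lt_trans ltr01 b1)).
  by rewrite E.
have : 1 * 2 <= (8 * `|w| - `|n|) * (8 * `|w| + `|n|) by apply: ler_pM.
by rewrite E.
Qed.

Section Family.

Variables (N : nat) (r kap s j z h' : int).

Let p := r ^+ 2.
Let m := 2 * h' + p.
Let g := m + p.
Let h := 2 * h'.
Let W := g * h.
Let T := kap * (W + 4 * p * j).
Let A := 8 * kap * p * T - 1.
Let B := 8 * kap * p.
Let k := 16 * kap ^+ 2 * p * h ^+ 2 - 1.
Let D := T ^+ 2 - h' - j.
Let x := 4 * kap * g * T - 1.
Let y := 4 * kap * g.

Hypothesis krh_neq0 : kap * r * h' != 0.
Hypothesis sE : 8 * kap * r ^+ 3 = s ^+ N.
Hypothesis zE : z ^+ N = 1 + 16 * kap ^+ 2 * W * j.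
Hypothesis zk : (k %| s ^+ 2 * z - 1)%Z.
Hypothesis k_coprime : coprimez k (32 * kap ^+ 2 * p * g * h).
Hypothesis z_coprime : coprimez z (2 * (4 * kap ^+ 2 * W ^+ 2 - m)).

Lemma family_norm : x ^+ 2 - D * y ^+ 2 = z ^+ N.
Proof. by rewrite zE /x /y /D /T /W /g /h /m; ring. Qed.

Lemma family_unit : A ^+ 2 + k = D * B ^+ 2.
Proof. by rewrite /A /B /k /D /T /W /g /h /m; ring. Qed.

(** A prime common to x and z divides h x - p z^N = 4 kap^2 W^2 - m. *)
Lemma family_coprime : (0 < N)%N -> coprimez (2 * x) z.
Proof.
move=> N0; move: z_coprime; rewrite coprimezMr => /andP[z2 zd].
rewrite coprimezMl coprimez_sym z2 /=.
have /coprimezP[[u v] /= uv] := zd; apply/coprimezP.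
exists (v * h, u - v * p * z ^+ N.-1) => /=.
have zN : z ^+ N = z * z ^+ N.-1 by rewrite -exprS prednK.
have E : 4 * kap ^+ 2 * W ^+ 2 - m = h * x + p * - z ^+ N.
  by rewrite zE /x /T /W /g /h /m; ring.
by rewrite -uv E zN; ring.
Qed.

(** A multiple of A by a factor prime to k is
k (16 kap^2 p g^2 - 1) + (s^2 z)^N - 1, and s^2 z = 1 modulo k. *)
Lemma family_dvd : (k %| A)%Z.
Proof.
have sN : (s ^+ 2) ^+ N = 64 * kap ^+ 2 * p ^+ 3.
  by rewrite exprAC -sE /p; ring.
have [q qE] : exists q, (s ^+ 2 * z) ^+ N - 1 = k * q.
  have /dvdzP[q qE] := zk; rewrite subrX1 qE.
  by exists (q * (\sum_(i < N) (s ^+ 2 * z) ^+ i)); rewrite mulrCA mulrA.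
have E : 32 * kap ^+ 2 * p * g * h * A = k * (16 * kap ^+ 2 * p * g ^+ 2 - 1 + q).
  rewrite [RHS]mulrDr -qE exprMn sN zE /A /k /T /W /g /h /m; ring.
by rewrite -(Gauss_dvdzr _ k_coprime) E dvdz_mulr.
Qed.

(** Here k = (8 w)^2 - 1, because h is even. *)
Lemma family_k : 0 < k /\ ~ perfect_square k.
Proof.
have kE : k = (4 * kap * r * h) ^+ 2 - 1 by rewrite /k /p; ring.
have [w wE w0] : exists2 w : int, 4 * kap * r * h = 8 * w & w != 0.
  by exists (kap * r * h') => //; rewrite /h; ring.
rewrite kE wE; exact: sqr_pred_nonsquare.
Qed.

(** The three local conditions bear on A: where h = 0 one has k = -1, so gam
with 2 A = gam + 1/gam is A + B dl for a square root dl of D; where g = 0,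
likewise, 2 A = eta - k/eta says that eta is A + B dl. *)
Definition family_generator := exists (F : fieldType) (gam i : F),
  [/\ h%:~R = 0 :> F /\ B%:~R != 0 :> F, i ^+ 2 = -1,
      gam != 0 /\ gam ^+ 2 != 1, 2 * A%:~R = gam + gam^-1
    & forall q, prime q -> (q %| N)%N -> forall t : F, t ^+ q <> gam].

Definition family_nonsquare := exists (F : fieldType) (i : F),
  [/\ h%:~R = 0 :> F, B%:~R != 0 :> F, i ^+ 2 = -1
    & forall t : F, t ^+ 2 <> A%:~R ^+ 2 - 1].

Definition family_independent := exists (F : fieldType) (eta : F),
  [/\ g%:~R = 0 :> F /\ B%:~R != 0 :> F, eta != 0 /\ k%:~R != 0 :> F,
      2 * A%:~R = eta - k%:~R / eta, eta ^+ 2 != - k%:~R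
    & forall q, prime q -> odd q -> (q %| N)%N ->
        forall t : F, k%:~R * t ^+ q <> eta ^+ 2].

Lemma family_k_mod (F : fieldType) : h%:~R = 0 :> F -> k%:~R = -1 :> F.
Proof. by move=> h0; rewrite /k intrB intrM /= rmorphXn /= h0; ring. Qed.

Lemma family_unit_mod (F : fieldType) : D%:~R * B%:~R ^+ 2 = A%:~R ^+ 2 + k%:~R :> F.
Proof.
have /(congr1 (intr : int -> F)) := family_unit.
by rewrite intrD intrM !rmorphXn.
Qed.

Lemma family_two_neq0 (F : fieldType) : B%:~R != 0 :> F -> 2 != 0 :> F.
Proof.
apply: contra_neq => F2; have -> : B = 2 * (4 * kap * p) by rewrite /B; ring.
by rewrite intrM (F2 : 2%:~R = 0 :> F) mul0r.
Qed.

(** The second condition makes D and k D nonsquares at once: where h = 0,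
D B^2 = A^2 - 1 is no square, k = -1 and -1 is a square.  In the other two
conditions D acquires an explicit square root dl, and x + y dl is computed by
x = A + 4 kap T h, y = B + 4 kap h, or by x = 4 kap T g - 1, y = 4 kap g. *)
Lemma family_certificate : (0 < N)%N ->
  family_generator -> family_nonsquare -> family_independent ->
  certificate N D x y z A B k.
Proof.
move=> N0 gen nonsq indep; have [k0 k_nsq] := family_k.
have [F [i [h0 B0 i2 nsq]]] := nonsq.
have D_nsq (e n : int) : e * n ^+ 2 = D -> (e%:~R : F) = 1 \/ e%:~R = -1 :> F -> False.
  move=> /(congr1 (intr : int -> F)); rewrite intrM rmorphXn /= => nE eE.
  have := family_unit_mod F; rewrite -nE (family_k_mod h0); case: eE => -> E.
    by apply: (nsq (n%:~R * B%:~R)); rewrite exprMn -[_ - 1]E mul1r.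
  by apply: (nsq (i * n%:~R * B%:~R)); rewrite !exprMn i2 -[_ - 1]E.
split=> //.
- exact: family_norm.
- exact: family_coprime.
- exact: family_unit.
- exact: family_dvd.
- move=> [n nE].
  have /(congr1 (intr : int -> F)) := nE.
  rewrite intrM rmorphXn /= (family_k_mod h0) mulN1r => DE.
  have := family_unit_mod F; rewrite (family_k_mod h0) -[D%:~R]opprK DE => E.
  by apply: (nsq (i * n%:~R * B%:~R)); rewrite !exprMn i2 -[_ - 1]E mulN1r.
- move=> [n nE]; apply: (D_nsq 1 n); first by rewrite mul1r.
  by left.
- have {h0 B0 i2 nsq D_nsq}[F' [gam [i' [[h0 B0] i2 [gam0 gam1] AE npow]]]] := gen.
  have F2 := family_two_neq0 B0.
  pose dl := (gam - gam^-1) / (2 * B%:~R).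
  have AE' : A%:~R = (gam + gam^-1) / 2 by rewrite -AE mulrC mulKf.
  have DE : dl ^+ 2 = D%:~R.
    apply: (@mulIf _ (B%:~R ^+ 2)); first by rewrite expf_neq0.
    by rewrite family_unit_mod AE' (family_k_mod h0) /dl; field; rewrite gam0 B0 F2.
  have dl0 : dl != 0.
    rewrite mulf_neq0 ?invr_eq0 ?mulf_neq0 //.
    apply: contra_neq gam1 => /eqP; rewrite subr_eq0 => /eqP E.
    by rewrite expr2 {2}E divff.
  have al : x%:~R + y%:~R * dl = gam.
    have -> : x = A + 4 * kap * T * h by rewrite /x /A /g /m /h; ring.
    have -> : y = B + 4 * kap * h by rewrite /y /B /g /m /h; ring.
    rewrite (intrD _ A) (intrD _ B) !(intrM _ _ h) h0 !mulr0 !addr0.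
    by rewrite AE' /dl; field; rewrite gam0 B0 F2.
  have eta : A%:~R + B%:~R * dl = gam.
    by rewrite AE' /dl; field; rewrite gam0 B0 F2.
  exists F', dl, i'; split=> //.
  + by rewrite intrM /= -DE mulf_neq0 // expf_neq0.
  + by rewrite eta al (family_k_mod h0) opprK mul1r oppr_eq0 oner_eq0.
  by rewrite al.
have {h0 B0 i2 nsq D_nsq}[F' [eta [[g0 B0] [eta0 kF] AE eta2 npow]]] := indep.
have F2 := family_two_neq0 B0.
pose dl := (eta + k%:~R / eta) / (2 * B%:~R).
have AE' : A%:~R = (eta - k%:~R / eta) / 2 by rewrite -AE mulrC mulKf.
have DE : dl ^+ 2 = D%:~R.
  apply: (@mulIf _ (B%:~R ^+ 2)); first by rewrite expf_neq0.
  by rewrite family_unit_mod AE' /dl; field; rewrite eta0 B0 F2.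
have dl0 : dl != 0.
  rewrite mulf_neq0 ?invr_eq0 ?mulf_neq0 //.
  apply: contra_neq eta2 => /eqP; rewrite addr_eq0 => /eqP E.
  by rewrite expr2 {2}E mulrN mulrC divfK.
have eE : A%:~R + B%:~R * dl = eta.
  by rewrite AE' /dl; field; rewrite eta0 B0 F2.
exists F', dl; split=> //.
- by rewrite intrM /= -DE mulf_neq0 // expf_neq0.
- have -> : x = 4 * kap * T * g - 1 by rewrite /x; ring.
  by rewrite /y intrB !(intrM _ _ g) g0 !mulr0 mul0r sub0r addr0.
by rewrite eE.
Qed.

End Family.

(** * Congruence conditions that can be met *)

Lemma crt_primes (ls : seq nat) (f : nat -> nat) (M a b : nat) :
  uniq ls -> (forall l, l \in ls -> prime l) -> (0 < M)%N ->
  (forall l, l \in ls -> coprime M l) ->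
  exists x, [/\ (b <= x)%N, x = a %[mod M] & forall l, l \in ls -> x = f l %[mod l]].
Proof.
elim: ls M a => [|l ls IH] M a /=.
  move=> _ _ M0 _; exists (a + M * b)%N; split=> //.
    by rewrite (leq_trans (leq_pmull b M0)) // leq_addl.
  by rewrite addnC mulnC modnMDl.
move=> /andP[lls uls] lsP M0 Mls.
have pl : prime l by apply: lsP; rewrite mem_head.
have Ml : coprime M l by apply: Mls; rewrite mem_head.
have H1 q : q \in ls -> prime q by move=> qls; apply: lsP; rewrite inE qls orbT.
have H2 : (0 < M * l)%N by rewrite muln_gt0 M0 prime_gt0.
have H3 q : q \in ls -> coprime (M * l) q.
  move=> qls; rewrite coprimeMl Mls ?inE ?qls ?orbT //=.
  rewrite prime_coprime // dvdn_prime2 ?(H1 q qls) //.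
  by apply: contra lls => /eqP ->.
have [x [bx xM xls]] := IH _ (chinese M l a (f l)) uls H1 H2 H3.
exists x; split=> //.
  have := congr1 (modn^~ M) xM; rewrite !modn_dvdm ?dvdn_mulr //.
  by rewrite chinese_modl.
move=> q; rewrite inE => /predU1P[->|]; last exact: xls.
have := congr1 (modn^~ l) xM; rewrite !modn_dvdm ?dvdn_mull //.
by rewrite chinese_modr.
Qed.

Lemma crt_Fp (ls : seq nat) (M a b : nat) (Q : forall l : nat, 'F_l -> Prop) :
  uniq ls -> (forall l, l \in ls -> prime l) -> (0 < M)%N ->
  (forall l, l \in ls -> coprime M l) ->
  (forall l, l \in ls -> exists v : 'F_l, Q l v) ->
  exists x, [/\ (b <= x)%N, x = a %[mod M] & forall l, l \in ls -> Q l x%:R].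
Proof.
move=> uls lsP M0 Mls Qls.
have /choice[f fQ] : forall l, exists n : nat, l \in ls -> Q l n%:R.
  move=> l; have [lls|nls] := boolP (l \in ls); last by exists 0%N.
  by have [v Qv] := Qls l lls; exists (v : nat) => _; rewrite natr_Zp.
have [x [bx xM xls]] := crt_primes f a b uls lsP M0 Mls.
exists x; split=> // l lls; have pl := lsP l lls.
by rewrite -(Fp_nat_mod pl) xls // Fp_nat_mod //; exact: fQ.
Qed.

(** Impose moreover z = 1 modulo the part of E that is prime to M. *)
Lemma coprime_in_class (M a E : nat) : (0 < M)%N -> (0 < E)%N -> coprime a M ->
  exists2 z, z = a %[mod M] & coprime z E.
Proof.
move=> M0 E0 aM; pose E' := (E`_(\pi(M)^'))%N.
have ME' : coprime M E'.
  by apply: (@pnat_coprime \pi(M)); rewrite ?part_pnat ?pnat_pi.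
pose z := (M * E' + chinese M E' a 1)%N.
have zMa : z = a %[mod M] by rewrite /z mulnC modnMDl chinese_modl.
have zE1 : z = 1 %[mod E'] by rewrite /z modnMDl chinese_modr.
have z0 : (0 < z)%N by rewrite addn_gt0 muln_gt0 M0 part_gt0.
exists z => //.
have zM : coprime z M by rewrite /coprime -gcdn_modl zMa gcdn_modl.
have zE' : coprime z E' by rewrite /coprime -gcdn_modl zE1 gcdn_modl gcd1n.
rewrite -(partnC \pi(M) E0) coprimeMr zE' andbT coprime_sym.
apply: (@pnat_coprime \pi(M)); rewrite ?part_pnat //.
by rewrite -coprime_pi' // coprime_sym.
Qed.

(** The factors 8 and m make -1 and m squares modulo l; the factor N makes the
p-th powers a proper subgroup for each prime p | N. *)
Definition good_prime (N m l : nat) :=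
  [/\ prime l, (8 < l)%N & (8 * m * N %| l.-1)%N].

Section LocalTargets.

Variables (N m l : nat).
Hypothesis good_l : good_prime N m l.

Let pl : prime l. Proof. by case: good_l. Qed.
Let l_gt8 : (8 < l)%N. Proof. by case: good_l. Qed.
Let l_mod : (8 * m * N %| l.-1)%N. Proof. by case: good_l. Qed.

Let mN_gt0 : (0 < 8 * m * N)%N.
Proof. by have := l_mod; rewrite lt0n; case: eqP => // ->; rewrite dvd0n; lia. Qed.

Let m_gt0 : (0 < m)%N. Proof. by move: mN_gt0; rewrite !muln_gt0 => /andP[]. Qed.
Let N_gt0 : (0 < N)%N. Proof. by move: mN_gt0; rewrite !muln_gt0 => /andP[]. Qed.

Lemma good_N_gt0 : (0 < N)%N. Proof. exact: N_gt0. Qed.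

Definition generator_target (A : 'F_l) :=
  exists2 gam : 'F_l, l.-1.-primitive_root gam & 2 * A = gam + gam^-1.

Definition nonsquare_target (A : 'F_l) := forall t, t ^+ 2 <> A ^+ 2 - 1.

Definition independent_target (k A : 'F_l) := exists eta : 'F_l,
  [/\ eta != 0, 2 * A = eta - k / eta, eta ^+ 2 != - k
    & forall q, prime q -> odd q -> (q %| N)%N ->
        forall t, k * t ^+ q <> eta ^+ 2].

Lemma prim_root_npow (q : nat) (gam t : 'F_l) : l.-1.-primitive_root gam ->
  prime q -> (q %| 2 * N)%N -> t ^+ q <> gam.
Proof.
move=> gP pq qN; apply: (prim_root_notpower gP) => //.
  by move=> x; exact: Fp_expn_pred.
apply: dvdn_trans qN (dvdn_trans _ l_mod).
by rewrite dvdn_mul // (_ : 8 * m = 2 * (4 * m))%N ?dvdn_mulr //; lia.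
Qed.

Lemma good_dvd : (8 * m %| l.-1)%N.
Proof. by apply: dvdn_trans l_mod; rewrite dvdn_mulr. Qed.

Lemma Fp_sqrt_m1 : exists i : 'F_l, i ^+ 2 = -1.
Proof.
have [gam gP] := Fp_primitive_root pl.
have [wE _ _] := prim_root_sqrt_m1 m_gt0 (dvdn_prim_root gP good_dvd).
exists ((gam ^+ (l.-1 %/ (8 * m))) ^+ (2 * m)); rewrite -wE -exprM.
by congr (_ ^+ _); lia.
Qed.

Lemma Fp_sqrt_m : exists t : 'F_l, t ^+ 2 = m%:R.
Proof.
have [gam gP] := Fp_primitive_root pl.
exact: square_of_prim_root m_gt0 (dvdn_prim_root gP good_dvd).
Qed.

Lemma Fp_nat_neq0 n : (0 < n)%N -> (n < l)%N -> n%:R != 0 :> 'F_l.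
Proof.
move=> n0 nl; rewrite -(dvdn_pcharf (pchar_Fp pl)).
by apply/negP => /(dvdn_leq n0); rewrite leqNgt nl.
Qed.

Lemma good_lt : (8 * m * N < l)%N.
Proof.
have : (8 * m * N <= l.-1)%N by apply: dvdn_leq l_mod; have := prime_gt1 pl; lia.
by have := prime_gt1 pl; lia.
Qed.

Lemma double_lt_pred : (2 * N < l.-1)%N.
Proof.
have : (8 * m * N <= l.-1)%N by apply: dvdn_leq l_mod; move: (prime_gt1 pl); lia.
by move: m_gt0 N_gt0; clear; nia.
Qed.

Lemma Fp2_neq0 : 2%:R != 0 :> 'F_l.
Proof. by apply: Fp_nat_neq0 => //; lia. Qed.

Lemma FpN_neq0 : N%:R != 0 :> 'F_l.
Proof. by apply: Fp_nat_neq0 => //; have := good_lt; nia. Qed.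

Lemma Fpm_neq0 : m%:R != 0 :> 'F_l.
Proof. by apply: Fp_nat_neq0 => //; have := good_lt; nia. Qed.

Lemma prim_root_pow_neq1 (gam : 'F_l) n : l.-1.-primitive_root gam ->
  (0 < n)%N -> (n < l.-1)%N -> gam ^+ n != 1.
Proof.
move=> gP n0 nl; rewrite -(prim_order_dvd gP).
by apply/negP => /(dvdn_leq n0); rewrite leqNgt nl.
Qed.

Lemma generator_target_exists : exists A, generator_target A.
Proof.
have [gam gP] := Fp_primitive_root pl.
by exists ((gam + gam^-1) / 2), gam => //; rewrite mulrC divfK // Fp2_neq0.
Qed.

(** If A = (1 + gam) / (1 - gam), then A^2 - 1 is gam times a nonzero square. *)
Lemma nonsquare_target_exists : exists A, nonsquare_target A.
Proof.
have [gam gP] := Fp_primitive_root pl; have F2 := Fp2_neq0.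
have g1 : 1 - gam != 0.
  rewrite subr_eq0 eq_sym -[gam]expr1; apply: prim_root_pow_neq1 => //; lia.
exists ((1 + gam) / (1 - gam)) => t tE.
apply: (@prim_root_npow 2 gam (t * (1 - gam) / 2)) => //; first exact: dvdn_mulr.
by rewrite !exprMn tE; field; rewrite g1 F2.
Qed.

(** Let gam be a primitive root.  According to the parity of the discrete logarithm
of k, one of gam k and gam^2 k is a square eta^2; then k t^q = eta^2 would make
gam or gam^2 a q-th power. *)
Lemma independent_target_exists k : k != 0 -> exists A, independent_target k A.
Proof.
move=> k0; have [gam gP] := Fp_primitive_root pl; have F2 := Fp2_neq0.
have g0 := prim_root_neq0 gP.
suff [eta [a [eta0 a12 etaE]]] : exists (eta : 'F_l) (a : nat),
    [/\ eta != 0, (0 < a <= 2)%N & eta ^+ 2 = gam ^+ a * k].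
  exists ((eta - k / eta) / 2), eta; split=> //.
  - by rewrite mulrC divfK.
  - rewrite etaE -mulN1r (inj_eq (mulIf k0)); apply/eqP => E.
    have : gam ^+ (a * 2) != 1 by apply: prim_root_pow_neq1 => //; lia.
    by rewrite exprM E sqrrN expr1n eqxx.
  move=> q pq oq qN t; rewrite etaE mulrC => /(mulIf k0) tE.
  have q2N : (q %| 2 * N)%N by rewrite dvdn_mull.
  case: a a12 tE {etaE} => [|[|[|//]]] // _ tE.
    by apply: (@prim_root_npow q gam t).
  have t0 : t != 0.
    apply: contra_eq_neq tE => ->.
    by rewrite expr0n gtn_eqF ?prime_gt0 // eq_sym expf_neq0.
  apply: (@prim_root_npow q gam (gam / t ^+ q./2)) => //.
  rewrite expr_div_n -exprM mulnC exprM tE -exprM.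
  have qE : q = (2 * q./2).+1 by have := odd_double_half q; rewrite oq -muln2; lia.
  by rewrite {1}qE exprS mulfK // expf_neq0.
have kP : k ^+ l.-1 = 1 by exact: Fp_expn_pred.
have [[e _] /= kE] := prim_rootP gP kP.
have eE := odd_double_half e.
have [oe|ee] := boolP (odd e).
  exists (gam ^+ (e./2).+1), 1%N; split; rewrite ?expf_neq0 //.
  by rewrite kE -exprM -exprD; congr (_ ^+ _); lia.
exists (gam ^+ (e./2).+1), 2%N; split; rewrite ?expf_neq0 //.
by rewrite kE -exprM -exprD; congr (_ ^+ _); lia.
Qed.

End LocalTargets.

(** Since J = N y modulo w, the choice of y prescribes J there. *)
Lemma pow_one_add (w y : int) (N : nat) : exists J t : int,
  (1 + w * y) ^+ N = 1 + w * J /\ J = N%:R * y + w * t.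
Proof.
elim: N => [|N [J [t [E JE]]]]; first by exists 0, 0; rewrite expr0; split; ring.
exists (J + y + w * (J * y)), (t + J * y); rewrite exprS E; split; first by ring.
by rewrite {1}JE -natr1; ring.
Qed.

(** * Choice of the parameters *)

Lemma coprime_primes (a b : nat) : (0 < a)%N ->
  (forall q, prime q -> (q %| a)%N -> (q %| b)%N -> False) -> coprime a b.
Proof.
move=> a0 H; apply: contraT => ncop.
have g0 : (0 < gcdn a b)%N by rewrite gcdn_gt0 a0.
have pq : prime (pdiv (gcdn a b)).
  by apply: pdiv_prime; rewrite ltn_neqAle eq_sym g0 andbT.
have := pdiv_dvd (gcdn a b); rewrite dvdn_gcd => /andP[qa qb].
by case: (H _ pq qa qb).
Qed.

Section CertificateFromTargets.

Variables (N m : nat) (r kap s j z h' : int).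

Local Notation p := (r ^+ 2).
Local Notation g := (2 * h' + p + p).
Local Notation h := (2 * h').
Local Notation A := (8 * kap * p * (kap * (g * h + 4 * p * j)) - 1).
Local Notation B := (8 * kap * p).
Local Notation k := (16 * kap ^+ 2 * p * h ^+ 2 - 1).

Lemma certificate_of_targets la lb le :
  good_prime N m la -> good_prime N m lb -> good_prime N m le ->
  kap * r * h' != 0 -> 8 * kap * r ^+ 3 = s ^+ N ->
  z ^+ N = 1 + 16 * kap ^+ 2 * (g * h) * j ->
  (k %| s ^+ 2 * z - 1)%Z -> coprimez k (32 * kap ^+ 2 * p * g * h) ->
  coprimez z (2 * (4 * kap ^+ 2 * (g * h) ^+ 2 - (2 * h' + p))) ->
  h%:~R = 0 :> 'F_la -> B%:~R != 0 :> 'F_la -> generator_target (A%:~R : 'F_la) ->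
  h%:~R = 0 :> 'F_le -> B%:~R != 0 :> 'F_le -> nonsquare_target (A%:~R : 'F_le) ->
  g%:~R = 0 :> 'F_lb -> B%:~R != 0 :> 'F_lb -> k%:~R != 0 :> 'F_lb ->
  independent_target N (k%:~R : 'F_lb) A%:~R ->
  exists x y A' B' k', certificate N
    ((kap * (g * h + 4 * p * j)) ^+ 2 - h' - j) x y z A' B' k'.
Proof.
move=> good_a good_b good_e krh sE zE zk kc zc.
move=> ha Ba [gam gP gA] he Be nsq gb Bb kb [eta [eta0 etaA eta2 etaP]].
have N0 := good_N_gt0 good_a.
do 5!eexists; apply: (@family_certificate N r kap s j z h') => //.
- have [i iE] := Fp_sqrt_m1 good_a.
  exists 'F_la, gam, i; split=> //.
    split; first exact: prim_root_neq0 gP.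
    by apply: (prim_root_pow_neq1 gP) => //; case: good_a => _ + _; clear; lia.
  move=> q pq qN t; apply: (prim_root_npow good_a gP pq).
  by rewrite dvdn_mull.
- have [i iE] := Fp_sqrt_m1 good_e.
  by exists 'F_le, i; split.
by exists 'F_lb, eta; split.
Qed.

End CertificateFromTargets.

Lemma part_notin_dvd (ls : seq nat) n q : (0 < n)%N -> prime q -> (q %| n)%N ->
  q \notin ls -> (q %| n`_[pred x | x \notin ls])%N.
Proof.
move=> n0 pq qn qls.
have : q \in primes n`_[pred x | x \notin ls].
  by rewrite primes_part mem_filter /= inE qls mem_primes pq n0.
by rewrite mem_primes => /and3P[].
Qed.

Lemma part_notin_coprime (ls : seq nat) n l : prime l -> l \in ls ->
  coprime n`_[pred x | x \notin ls] l.
Proof.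
move=> pl lls; rewrite coprime_sym prime_coprime //; apply/negP => ln.
have n0 : (0 < n`_[pred x | x \notin ls])%N by exact: part_gt0.
have : l \in primes n`_[pred x | x \notin ls] by rewrite mem_primes pl n0.
by rewrite primes_part mem_filter /= inE lls.
Qed.

Lemma mod_inverse (a K : nat) : (0 < a)%N -> coprime a K ->
  exists b, (b * a = 1 %[mod K])%N.
Proof.
move=> a0 cop; case: (egcdnP K a0) => b c bc _; exists b.
by rewrite bc (eqP cop) modnMDl.
Qed.

Lemma eqmodn_dvd (a b d M : nat) : (d %| M)%N -> a = b %[mod M] -> a = b %[mod d].
Proof. by move=> dM ab; rewrite -(modn_dvdm a dM) ab modn_dvdm. Qed.

Lemma eqmodn_int (a b M : nat) : a = b %[mod M] ->
  exists t : int, a%:Z = b%:Z + M%:Z * t.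
Proof.
move=> ab; exists ((a %/ M)%N%:Z - (b %/ M)%N%:Z).
by rewrite {1}(divn_eq a M) {1}(divn_eq b M) ab !PoszD !PoszM; ring.
Qed.

(** Solves 8 kappa r^3 = s^N, with s = 8 r^3 c. *)
Lemma conductor_power (N r c : nat) : (0 < N)%N ->
  (8 * (8 ^ N.-1 * r ^ (3 * N.-1) * c ^ N) * r ^ 3 = (8 * r ^ 3 * c) ^ N)%N.
Proof.
case: N => // n _ /=; rewrite (expnMn (8 * r ^ 3)) (expnMn 8) -expnM mulnS expnD (expnS 8 n).
by move: (8 ^ n)%N (r ^ (3 * n))%N (c ^ n.+1)%N (r ^ 3)%N => a b d e; ring.
Qed.

Lemma sixteen_squares_gt1 (a b c : nat) : (0 < a)%N -> (0 < b)%N -> (0 < c)%N ->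
  (1 < 16 * a ^ 2 * b ^ 2 * c ^ 2)%N.
Proof.
move=> a0 b0 c0; apply: (@leq_trans 16) => //.
by rewrite -!mulnA leq_pmulr // !muln_gt0 a0 b0 c0.
Qed.

Lemma PoszX (a n : nat) : (a ^ n)%N%:Z = a%:Z ^+ n.
Proof. by rewrite -[LHS]natz natrX natz. Qed.

(** In both fields W = - gn hn and j = - J, with gn = m + r^2 and hn = r^2 - m.
Taking h = - hn, g = gn gives D; taking h = - gn, g = hn amounts to replacing m
by - m, and gives D + m. *)
Theorem certificates_exist (N m : nat) : (0 < N)%N -> (0 < m)%N ->
  exists D : int,
    (exists x y z A B k, certificate N D x y z A B k) /\
    (exists x y z A B k, certificate N (D + m%:Z) x y z A B k).
Proof.
move=> N0 m0; have n0 : (0 < 8 * m * N)%N by rewrite !muln_gt0 m0 N0.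
have [ls0 [sz uls lsP]] := primes_1_mod 8 6 n0.
case: ls0 sz uls lsP => [|l1 [|l2 [|l3 [|l4 [|l5 [|l6 [|//]]]]]]] // _.
set ls := [:: l1; l2; l3; l4; l5; l6] => uls lsP.
have lsgood l : l \in ls -> good_prime N m l by move=> /lsP.
have lsp l : l \in ls -> prime l by case/lsgood.
pose hs := [:: l1; l2; l3].
(* The parity of r makes hn even; the primes of hs will divide hn, the others gn. *)
have [r [mr rm2 rF]] : exists r, [/\ (m < r)%N, r = m %[mod 2] & forall l, l \in ls ->
    (r%:R : 'F_l) ^+ 2 = if l \in hs then m%:R else - m%:R].
  apply: (@crt_Fp ls 2 m m.+1
    (fun l (v : 'F_l) => v ^+ 2 = if l \in hs then m%:R else - m%:R)) => //.
    move=> l /lsgood[pl l8 _]; rewrite coprime2n.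
    by case: (even_prime pl) => // l2'; rewrite l2' in l8.
  move=> l /lsgood lgood; have [t tE] := Fp_sqrt_m lgood.
  have [i iE] := Fp_sqrt_m1 lgood.
  case: ifP => _; first by exists t.
  by exists (i * t); rewrite exprMn iE tE mulN1r.
have r0 : (0 < r)%N by exact: leq_ltn_trans mr.
have [u rE u0] : exists2 u, (r ^ 2 = m + 2 * u)%N & (0 < u)%N.
  have odd2 : odd (r ^ 2) = odd m.
    by rewrite oddX /=; move: rm2; rewrite !modn2; case: (odd r); case: (odd m).
  have lt : (m < r ^ 2)%N by nia.
  exists ((r ^ 2 - m)./2); last by move: odd2; lia.
  by move: odd2; lia.
pose gn := (m + r ^ 2)%N; pose hn := (2 * u)%N.
have gn0 : (0 < gn)%N by rewrite addn_gt0 m0.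
have hn0 : (0 < hn)%N by rewrite muln_gt0 u0.
have pF l : l \in ls -> ((r ^ 2)%:R : 'F_l) = if l \in hs then m%:R else - m%:R.
  by move=> lls; rewrite natrX rF.
have mF l : l \in ls -> m%:R != 0 :> 'F_l.
  by move=> /lsgood/Fpm_neq0.
have F2 l : l \in ls -> 2%:R != 0 :> 'F_l.
  by move=> /lsgood/Fp2_neq0.
have hF l : l \in ls -> l \in hs -> hn%:R = 0 :> 'F_l.
  move=> lls lh; have := pF l lls; rewrite lh rE natrD => /eqP.
  by rewrite -subr_eq0 addrAC subrr add0r => /eqP.
have gF l : l \in ls -> l \notin hs -> gn%:R = 0 :> 'F_l.
  by move=> lls /negPf lh; rewrite natrD pF // lh subrr.
have gnE : gn = (m + r ^ 2)%N by [].
have hnE : hn = (2 * u)%N by [].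
clearbody gn hn.
have rF0 l : l \in ls -> r%:R != 0 :> 'F_l.
  move=> lls; have := mF l lls; apply: contra_neq => r00; have := rF l lls.
  by rewrite r00 expr0n /=; case: ifP => _ // /eqP; rewrite eq_sym oppr_eq0 => /eqP.
pose G := ((gn * hn)`_[pred x | x \notin ls])%N.
(* The prime factors of gn hn other than the six primes divide c, hence kappa, so
   they do not divide k. *)
have [c [c0 cG cF]] : exists c, [/\ (0 < c)%N, c = 0 %[mod G] & forall l, l \in ls ->
    l.-1.-primitive_root ((8 * r ^ 3)%:R * c%:R : 'F_l)].
  apply: (@crt_Fp ls G 0 1
    (fun l (v : 'F_l) => l.-1.-primitive_root ((8 * r ^ 3)%:R * v))) => //.
  - exact: part_gt0.
  - by move=> l lls; apply: part_notin_coprime => //; exact: lsp.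
  move=> l lls; have [gam gP] := Fp_primitive_root (lsp l lls).
  exists (gam / (8 * r ^ 3)%:R); rewrite mulrC divfK // natrM mulf_neq0 //.
    by rewrite (natrX _ 2 3) expf_neq0 // F2.
  by rewrite natrX expf_neq0 // rF0.
pose s := (8 * r ^ 3 * c)%N.
have s0 : (0 < s)%N by rewrite !muln_gt0 r0 c0.
pose kap := (8 ^ N.-1 * r ^ (3 * N.-1) * c ^ N)%N.
have kap0 : (0 < kap)%N by rewrite !muln_gt0 !expn_gt0 r0 c0.
have sE : (8 * kap * r ^ 3 = s ^ N)%N.
  exact: conductor_power.
have sF l : l \in ls -> l.-1.-primitive_root (s%:R : 'F_l).
  by move=> lls; rewrite natrM; exact: cF.
have kapF l : l \in ls -> kap%:R != 0 :> 'F_l.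
  move=> lls; have : (s ^ N)%:R != 0 :> 'F_l.
    by rewrite natrX expf_neq0 //; exact: prim_root_neq0 (sF l lls).
  by rewrite -sE !natrM !mulf_eq0 !negb_or => /andP[/andP[]].
have s2N l : l \in ls -> (s%:R : 'F_l) ^+ (2 * N) != 1.
  move=> lls; apply: (prim_root_pow_neq1 (sF l lls)); first by rewrite muln_gt0 N0.
  exact: double_lt_pred (lsgood l lls).
have ckap q : prime q -> (q %| gn * hn)%N -> q \notin ls -> (q %| kap)%N.
  move=> pq qgh qls; have qG : (q %| G)%N.
    by apply: part_notin_dvd => //; rewrite muln_gt0 gn0 hn0.
  have qc : (q %| c)%N by apply: dvdn_trans qG _; rewrite /dvdn cG mod0n.
  by rewrite /kap dvdn_mull // dvdn_exp.
(* K1 and K2 are the values of k for D and D + m. *)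
pose K1 := (16 * kap ^ 2 * r ^ 2 * hn ^ 2).-1.
pose K2 := (16 * kap ^ 2 * r ^ 2 * gn ^ 2).-1.
have K1E : (16 * kap ^ 2 * r ^ 2 * hn ^ 2 = K1.+1)%N.
  by rewrite prednK // ltnW // sixteen_squares_gt1.
have K2E : (16 * kap ^ 2 * r ^ 2 * gn ^ 2 = K2.+1)%N.
  by rewrite prednK // ltnW // sixteen_squares_gt1.
have K10 : (0 < K1)%N by rewrite -ltnS -K1E sixteen_squares_gt1.
have K20 : (0 < K2)%N by rewrite -ltnS -K2E sixteen_squares_gt1.
have sNF l : l \in ls -> (s%:R : 'F_l) ^+ (2 * N) = 64 * kap%:R ^+ 2 * r%:R ^+ 6.
  move=> lls; rewrite mulnC exprM -(natrX _ s) -sE !natrM natrX; ring.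
clearbody kap K1 K2.
(* Where one of gn and hn vanishes, the other is 2 r^2, and then
   k + 1 = 64 kappa^2 r^6 = s^(2N). *)
have gh2 l : gn%:R + hn%:R = 2 * r%:R ^+ 2 :> 'F_l.
  by rewrite -natrX -natrM -natrD; congr _%:R; rewrite gnE hnE rE; lia.
have KF l (a K : nat) : l \in ls -> (16 * kap ^ 2 * r ^ 2 * a ^ 2 = K.+1)%N ->
    a%:R ^+ 2 = (2 * r%:R ^+ 2) ^+ 2 :> 'F_l -> (K%:R : 'F_l) = s%:R ^+ (2 * N) - 1.
  move=> lls KE aE; apply/eqP; rewrite eq_sym subr_eq natr1 -KE sNF //.
  by rewrite !(natrM, natrX) aE; apply/eqP; ring.
have K1F l : l \in ls -> gn%:R = 0 :> 'F_l -> (K1%:R : 'F_l) = s%:R ^+ (2 * N) - 1.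
  by move=> lls g0; apply: KF K1E _ => //; have := gh2 l; rewrite g0 add0r => ->.
have K2F l : l \in ls -> hn%:R = 0 :> 'F_l -> (K2%:R : 'F_l) = s%:R ^+ (2 * N) - 1.
  by move=> lls h0; apply: KF K2E _ => //; have := gh2 l; rewrite h0 addr0 => ->.
have cop a b K : (0 < b)%N -> (16 * kap ^ 2 * r ^ 2 * a ^ 2 = K.+1)%N -> (0 < K)%N ->
    (forall q, prime q -> (q %| b)%N -> (q %| gn * hn)%N) ->
    (forall l, l \in ls -> b%:R = 0 :> 'F_l -> (K%:R : 'F_l) = s%:R ^+ (2 * N) - 1) ->
    coprime K (32 * kap ^ 2 * r ^ 2 * a * b).
  move=> b0 KE K0 bgh KFl; apply: coprime_primes => // q pq qK.
  have ndvd d : (d %| K.+1)%N -> (q %| d)%N -> False.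
    move=> dK qd; have : (q %| K.+1 - K)%N by rewrite dvdn_sub // (dvdn_trans qd).
    by rewrite subSnn dvdn1 => /eqP q1; rewrite q1 in pq.
  have qkap : (q %| kap)%N -> False.
    by apply: ndvd; rewrite -KE -!mulnA dvdn_mull // dvdn_mulr // dvdn_exp.
  rewrite Euclid_dvdM // => /orP[qa|].
    have : (q %| 2 * K.+1)%N.
      apply: dvdn_trans qa _; rewrite -KE; apply/dvdnP; exists a.
      by rewrite -[(a ^ 2)%N]mulnn; ring.
    rewrite Euclid_dvdM // => /orP[q2|]; last exact: ndvd.
    apply: ndvd q2; rewrite -KE; apply/dvdnP.
    by exists (8 * kap ^ 2 * r ^ 2 * a ^ 2)%N; ring.
  move=> qb; have [qls|qls] := boolP (q \in ls); last first.
    by apply: qkap; apply: ckap => //; exact: bgh.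
  have b0q : b%:R = 0 :> 'F_q by apply/eqP; rewrite -(dvdn_pcharf (pchar_Fp pq)).
  have := KFl q qls b0q; have -> : K%:R = 0 :> 'F_q.
    by apply/eqP; rewrite -(dvdn_pcharf (pchar_Fp pq)).
  by move/eqP; rewrite eq_sym subr_eq0 (negPf (s2N q qls)).
have cop1 : coprime K1 (32 * kap ^ 2 * r ^ 2 * hn * gn).
  by apply: cop => // q pq qg; rewrite dvdn_mulr.
have cop2 : coprime K2 (32 * kap ^ 2 * r ^ 2 * gn * hn).
  by apply: cop => // q pq qg; rewrite dvdn_mull.
(* Of the primes dividing h, one serves the first reduction and one the
   nonsquares; one of those dividing g serves the second reduction.  The roles of
   g and h are exchanged between the two fields, whence six primes. *)
pose P l (A : 'F_l) :=
  if l \in [:: l1; l5] then generator_target A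
  else if l \in [:: l2; l4] then independent_target N (s%:R ^+ (2 * N) - 1) A
  else nonsquare_target A.
(* Modulo the six primes W = 0 and j = - N y, hence A = - e y - 1, any residue. *)
pose e := (32 * kap ^ 2 * r ^ 4 * N)%N.
have [y [_ _ yP]] : exists y, [/\ (0 <= y)%N, y = 0 %[mod 1] & forall l, l \in ls ->
    @P l (- (e%:R * y%:R) - 1)].
  apply: (@crt_Fp ls 1 0 0 (fun l (v : 'F_l) => @P l (- (e%:R * v) - 1))) => //.
    by move=> l _; rewrite coprime1n.
  move=> l lls; have lg := lsgood l lls.
  have e0 : e%:R != 0 :> 'F_l.
    rewrite /e natrM mulf_neq0 ?(FpN_neq0 lg) // natrM mulf_neq0 //; last first.
      by rewrite natrX expf_neq0 // rF0.
    rewrite natrM mulf_neq0 //; last by rewrite natrX expf_neq0 // kapF.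
    by rewrite (natrX _ 2 5) expf_neq0 // F2.
  suff [A0 A0P] : exists A0, @P l A0.
    exists (- (A0 + 1) / e%:R).
    by rewrite mulrC divfK // opprK addrK.
  rewrite /P; case: (l \in [:: l1; l5]); first exact: (generator_target_exists lg).
  case: (l \in [:: l2; l4]); last exact: (nonsquare_target_exists lg).
  by apply: (independent_target_exists lg); rewrite subr_eq0 s2N.
(* z = 1 + Om y modulo Om^2 controls j modulo the six primes, which divide Om;
   z s^2 = 1 modulo K1 K2 gives k | A for both fields. *)
pose Om := (16 * kap ^ 2 * (gn * hn))%N.
have Om0 : (0 < Om)%N by rewrite !muln_gt0 kap0 gn0 hn0.
have OmE : Om = (16 * kap ^ 2 * (gn * hn))%N by [].
clearbody Om.
have copOm a b K : (a * b = gn * hn)%N -> coprime K (32 * kap ^ 2 * r ^ 2 * a * b) ->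
    coprime K Om /\ coprime K s.
  move=> abE copK; have copK' := copK; move: copK'.
  rewrite -(mulnA _ a) coprimeMr => /andP[+ _].
  rewrite coprimeMr => /andP[+ Kr]; rewrite coprimeMr => /andP[K32 Kk]; split.
    apply: coprime_dvdr copK; rewrite OmE -(mulnA _ a b) abE dvdn_mul //.
    by rewrite dvdn_mulr // dvdn_mul.
  rewrite -(coprime_pexpr _ _ N0) -sE coprimeMr (coprime_pexpr _ r) //.
  rewrite coprimeMr -andbA; apply/and3P; split.
  - by rewrite (coprime_pexpr K 2 (_ : 0 < 3)%N) // -(coprime_pexpr K 2 (_ : 0 < 5)%N).
  - by rewrite -(coprime_pexpr K kap (_ : 0 < 2)%N).
  by rewrite -(coprime_pexpr K r (_ : 0 < 2)%N).
have [K1Om K1s] : coprime K1 Om /\ coprime K1 s by apply: copOm cop1; rewrite mulnC.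
have [K2Om K2s] : coprime K2 Om /\ coprime K2 s by apply: copOm cop2.
have OmK : coprime (Om ^ 2) (K1 * K2).
  by rewrite coprimeXl // coprimeMr ![coprime Om _]coprime_sym K1Om K2Om.
have [inv invE] : exists b, (b * s ^ 2 = 1 %[mod K1 * K2])%N.
  apply: mod_inverse; first by rewrite expn_gt0 s0.
  by rewrite coprimeXl // coprimeMr ![coprime s _]coprime_sym K1s K2s.
(* The common factors of 2 x and z divide 2 (4 kappa^2 W^2 - m) in one field and
   2 (4 kappa^2 W^2 + m) in the other. *)
pose E := (2 * ((4 * kap ^ 2 * (gn * hn) ^ 2 - m) * (4 * kap ^ 2 * (gn * hn) ^ 2 + m)))%N.
have m_lt : (m < 4 * kap ^ 2 * (gn * hn) ^ 2)%N.
  have mgn : (m < gn * hn)%N.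
    by rewrite (leq_trans _ (leq_pmulr _ hn0)) // gnE -addn1 leq_add2l expn_gt0 r0.
  apply: leq_trans mgn _; rewrite (leq_trans (leq_pmulr (gn * hn) (_ : 0 < gn * hn))%N) //.
    by rewrite muln_gt0 gn0.
  by rewrite -[(gn * hn * (gn * hn))%N]/((gn * hn) ^ 2)%N leq_pmull // !muln_gt0 kap0.
have E0 : (0 < E)%N by rewrite !muln_gt0 subn_gt0 m_lt addn_gt0 m0 orbT.
pose a0 := chinese (Om ^ 2) (K1 * K2) (1 + Om * y) inv.
have a0Om : a0 = 1 + Om * y %[mod Om ^ 2] by exact: chinese_modl.
have a0K : a0 = inv %[mod K1 * K2] by exact: chinese_modr.
have M0 : (0 < Om ^ 2 * (K1 * K2))%N by rewrite !muln_gt0 Om0 K10 K20.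
have a0M : coprime a0 (Om ^ 2 * (K1 * K2)).
  rewrite coprimeMr; apply/andP; split.
    rewrite /coprime -gcdn_modl a0Om gcdn_modl -/(coprime _ _) coprimeXr //.
    by rewrite /coprime gcdnC addnC mulnC gcdnMDl gcdn1.
  rewrite /coprime -gcdn_modl a0K gcdn_modl -/(coprime _ _).
  have : coprime (inv * s ^ 2) (K1 * K2).
    by rewrite /coprime -gcdn_modl invE gcdn_modl gcd1n.
  by rewrite coprimeMl => /andP[].
have [z za zE] := coprime_in_class M0 E0 a0M.
have zOm : z = 1 + Om * y %[mod Om ^ 2].
  by rewrite -a0Om; exact: (eqmodn_dvd (dvdn_mulr _ (dvdnn _)) za).
have zK : z * s ^ 2 = 1 %[mod K1 * K2].
  by rewrite -modnMml (eqmodn_dvd (dvdn_mull _ (dvdnn _)) za) a0K modnMml.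
have [t tE] := eqmodn_int zOm; have [q qE] := eqmodn_int zK.
have [J [t' [JE JE']]] := pow_one_add Om%:Z (y%:Z + Om%:Z * t) N.
have zNE : z%:Z ^+ N = 1 + Om%:Z * J.
  by rewrite tE PoszD PoszX PoszM -JE; congr (_ ^+ N); ring.
have rEz : r%:Z ^+ 2 = m%:Z + 2 * u%:Z by rewrite -PoszX rE.
have sEz : 8 * kap%:Z * r%:Z ^+ 3 = s%:Z ^+ N by rewrite -!PoszX -sE !PoszM.
have Omz : Om%:Z = 16 * kap%:Z ^+ 2 * (gn%:Z * hn%:Z) by rewrite OmE -!PoszX -!PoszM.
have gnz : gn%:Z = m%:Z + r%:Z ^+ 2 by rewrite gnE PoszD PoszX.
have hnz : hn%:Z = 2 * u%:Z by rewrite hnE PoszM.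
have K1z : 16 * kap%:Z ^+ 2 * r%:Z ^+ 2 * (- hn%:Z) ^+ 2 - 1 = K1%:Z.
  by rewrite sqrrN -!PoszX -!PoszM K1E -addn1 PoszD addrK.
have K2z : 16 * kap%:Z ^+ 2 * r%:Z ^+ 2 * (- gn%:Z) ^+ 2 - 1 = K2%:Z.
  by rewrite sqrrN -!PoszX -!PoszM K2E -addn1 PoszD addrK.
have zKz : s%:Z ^+ 2 * z%:Z - 1 = K1%:Z * K2%:Z * q.
  by rewrite [s%:Z ^+ 2 * _]mulrC -PoszX -(PoszM z) qE addrAC subrr add0r PoszM.
have NF (l : nat) (n : nat) : (n%:Z)%:~R = n%:R :> 'F_l by rewrite -pmulrn.
have AF l (W : int) : l \in ls -> W = - (gn%:Z * hn%:Z) ->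
    (8 * kap%:Z * r%:Z ^+ 2 * (kap%:Z * (W + 4 * r%:Z ^+ 2 * - J)) - 1)%:~R
    = - (e%:R * y%:R) - 1 :> 'F_l.
  move=> lls ->.
  have ghF : (gn%:Z * hn%:Z)%:~R = 0 :> 'F_l.
    rewrite intrM !NF; have [lh|lh] := boolP (l \in hs); first by rewrite hF ?mulr0.
    by rewrite gF ?mul0r.
  have ez : e%:Z = 32 * kap%:Z ^+ 2 * r%:Z ^+ 4 * N%:Z by rewrite -!PoszX -!PoszM.
  have -> : 8 * kap%:Z * r%:Z ^+ 2 * (kap%:Z * (- (gn%:Z * hn%:Z) + 4 * r%:Z ^+ 2 * - J)) - 1
     = (- (e%:Z * y%:Z) - 1) + gn%:Z * hn%:Z * (- 8 * kap%:Z ^+ 2 * r%:Z ^+ 2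
         - 512 * kap%:Z ^+ 4 * r%:Z ^+ 4 * (N%:Z * t + t')).
    by rewrite ez JE' Omz natz; ring.
  by rewrite intrD (intrM _ (gn%:Z * hn%:Z)) ghF mul0r addr0 intrB mulrNz intrM !NF.
have BF l : l \in ls -> (8 * kap%:Z * r%:Z ^+ 2)%:~R != 0 :> 'F_l.
  move=> lls; have -> : 8 * kap%:Z * r%:Z ^+ 2 = (2 ^ 3 * kap * r ^ 2)%N%:Z.
    by rewrite -!PoszX -!PoszM.
  by rewrite NF (natrM _ (2 ^ 3 * kap)) (natrM _ (2 ^ 3)) !natrX !mulf_neq0 ?expf_neq0 ?kapF ?rF0 // F2.
have zdvd (d : int) (K : nat) : (K%:Z %| K1%:Z * K2%:Z)%Z -> (K%:Z %| s%:Z ^+ 2 * z%:Z - 1)%Z.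
  by move=> KK; rewrite zKz dvdz_mulr.
move: (uls); rewrite /= !inE !negb_or -!andbA.
move=> /and5P[n12 n13 n14 n15 /and5P[n16 n23 n24 n25]].
move=> /and5P[n26 n34 n35 n36 /and4P[n45 n46 n56 _]].
have copz : coprimez z%:Z (2 * ((4 * kap%:Z ^+ 2 * (gn%:Z * hn%:Z) ^+ 2 - m%:Z)
    * (4 * kap%:Z ^+ 2 * (gn%:Z * hn%:Z) ^+ 2 + m%:Z))).
  have -> : 2 * ((4 * kap%:Z ^+ 2 * (gn%:Z * hn%:Z) ^+ 2 - m%:Z)
    * (4 * kap%:Z ^+ 2 * (gn%:Z * hn%:Z) ^+ 2 + m%:Z)) = E%:Z.
    rewrite -PoszM -!PoszX -!PoszM -PoszD subzn; last exact: ltnW.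
    by rewrite -!PoszM.
  exact: zE.
have yF l : l \in ls -> P l (- (e%:R * y%:R) - 1) by exact: yP.
(* Both fields at once: h = - a, g = b, and la, lb, le carry the first reduction,
   the second one and the nonsquares. *)
have cert (h' : int) (a b K la lb le : nat) : (a * b = gn * hn)%N ->
    2 * h' = - a%:Z -> - a%:Z + r%:Z ^+ 2 + r%:Z ^+ 2 = b%:Z ->
    (- a%:Z + r%:Z ^+ 2 = m%:Z \/ - a%:Z + r%:Z ^+ 2 = - m%:Z) ->
    16 * kap%:Z ^+ 2 * r%:Z ^+ 2 * (- a%:Z) ^+ 2 - 1 = K%:Z ->
    (K%:Z %| K1%:Z * K2%:Z)%Z -> coprime K (32 * kap ^ 2 * r ^ 2 * a * b) ->
    (K%:R : 'F_lb) = s%:R ^+ (2 * N) - 1 ->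
    [/\ la \in ls, a%:R = 0 :> 'F_la & generator_target (- (e%:R * y%:R) - 1 : 'F_la)] ->
    [/\ lb \in ls, b%:R = 0 :> 'F_lb &
        independent_target N (s%:R ^+ (2 * N) - 1) (- (e%:R * y%:R) - 1 : 'F_lb)] ->
    [/\ le \in ls, a%:R = 0 :> 'F_le & nonsquare_target (- (e%:R * y%:R) - 1 : 'F_le)] ->
    exists x y' A B k, certificate N
      ((kap%:Z * (- (gn%:Z * hn%:Z) + 4 * r%:Z ^+ 2 * - J)) ^+ 2 - h' - - J) x y' z A B k.
  move=> abE hE gE mE KE Kdvd Kcop KF' [lal a0a gen] [lbl b0b ind] [lel a0e nsq].
  have WE : b%:Z * - a%:Z = - (gn%:Z * hn%:Z) by rewrite -PoszM -abE PoszM; ring.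
  have h'0 : h' != 0.
    apply: contra_neq (_ : a%:Z != 0) => [h0|].
      by apply/eqP; rewrite -oppr_eq0 -hE h0 mulr0.
    have : (0 < a * b)%N by rewrite abE muln_gt0 gn0.
    by rewrite muln_gt0 => /andP[a_gt0 _]; rewrite -lt0n.
  have := @certificate_of_targets N m r%:Z kap%:Z s%:Z (- J) z%:Z h' la lb le.
  rewrite hE gE KE WE; apply.
  - exact: lsgood.
  - exact: lsgood.
  - exact: lsgood.
  - by rewrite !mulf_neq0 // -lt0n.
  - exact: sEz.
  - by rewrite zNE Omz; ring.
  - exact: zdvd.
  - have -> : 32 * kap%:Z ^+ 2 * r%:Z ^+ 2 * b%:Z * - a%:Z
      = - (32 * kap ^ 2 * r ^ 2 * a * b)%N%:Z.
      by rewrite (PoszM _ b) (PoszM _ a) (PoszM _ (r ^ 2)%N) (PoszM 32) !PoszX; ring.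
    by rewrite /coprimez gcdzN; exact: Kcop.
  - move: copz; rewrite !coprimezMr => /andP[-> /andP[cm cp]] /=; rewrite sqrrN.
    by case: mE => ->; rewrite ?opprK.
  - by rewrite mulrNz NF a0a oppr0.
  - exact: BF.
  - by rewrite AF.
  - by rewrite mulrNz NF a0e oppr0.
  - exact: BF.
  - by rewrite AF.
  - by rewrite NF.
  - exact: BF.
  - by rewrite NF KF' subr_eq0 s2N.
  by rewrite NF KF' AF.
have [gen1 ind4 nsq3] : [/\ generator_target (- (e%:R * y%:R) - 1 : 'F_l1),
    independent_target N (s%:R ^+ (2 * N) - 1) (- (e%:R * y%:R) - 1 : 'F_l4)
  & nonsquare_target (- (e%:R * y%:R) - 1 : 'F_l3)].
  split; [have := yF l1|have := yF l4|have := yF l3];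
    rewrite /P /ls !inE !eqxx ?orbT => /(_ isT) //.
    by rewrite eq_sym (negPf n14) (negPf n45).
  by rewrite !(eq_sym l3) (negPf n13) (negPf n23) (eq_sym l5) (eq_sym l4)
             (negPf n34) (negPf n35).
have [gen5 ind2 nsq6] : [/\ generator_target (- (e%:R * y%:R) - 1 : 'F_l5),
    independent_target N (s%:R ^+ (2 * N) - 1) (- (e%:R * y%:R) - 1 : 'F_l2)
  & nonsquare_target (- (e%:R * y%:R) - 1 : 'F_l6)].
  split; [have := yF l5|have := yF l2|have := yF l6];
    rewrite /P /ls !inE !eqxx ?orbT => /(_ isT) //.
    by rewrite (eq_sym l2) (negPf n12) (negPf n25).
  by rewrite !(eq_sym l6) (negPf n16) (negPf n26) (negPf n46) (negPf n56).
have in_ls : [/\ l1 \in ls, l2 \in ls & l3 \in ls] /\ [/\ l4 \in ls, l5 \in ls & l6 \in ls].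
  by rewrite /ls !inE !eqxx ?orbT.
case: in_ls => [[in1 in2 in3] [in4 in5 in6]].
have notin_hs : [/\ l4 \notin hs, l5 \notin hs & l6 \notin hs].
  rewrite !inE !negb_or ![_ == l1]eq_sym ![_ == l2]eq_sym ![_ == l3]eq_sym.
  by rewrite n14 n15 n16 n24 n25 n26 n34 n35 n36.
case: notin_hs => [out4 out5 out6].
have in_hs : [/\ l1 \in hs, l2 \in hs & l3 \in hs] by rewrite !inE !eqxx ?orbT.
case: in_hs => [in1' in2' in3'].
exists ((kap%:Z * (- (gn%:Z * hn%:Z) + 4 * r%:Z ^+ 2 * - J)) ^+ 2 + u%:Z + J); split.
  have [|||||||||||x [y' [A [B [k crt]]]]] := @cert (- u%:Z) hn gn K1 l1 l4 l3.
  - by rewrite mulnC.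
  - by rewrite hnz mulrN.
  - by rewrite gnz hnz rEz; ring.
  - by left; rewrite hnz rEz; ring.
  - exact: K1z.
  - by rewrite dvdz_mulr.
  - exact: cop1.
  - by apply: K1F => //; exact: gF.
  - by split=> //; exact: hF.
  - by split=> //; exact: gF.
  - by split=> //; exact: hF.
  by exists x, y', z%:Z, A, B, k; move: crt; rewrite !opprK.
have [|||||||||||x [y' [A [B [k crt]]]]] := @cert (- (m%:Z + u%:Z)) gn hn K2 l5 l2 l6.
- by [].
- by rewrite gnz rEz; ring.
- by rewrite gnz hnz rEz; ring.
- by right; rewrite gnz; ring.
- exact: K2z.
- by rewrite dvdz_mull.
- exact: cop2.
- by apply: K2F => //; exact: hF.
- by split=> //; exact: gF.
- by split=> //; exact: hF.
- by split=> //; exact: gF.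
exists x, y', z%:Z, A, B, k; move: crt; rewrite !opprK.
by rewrite [m%:Z + u%:Z]addrC addrA (addrAC _ m%:Z).
Qed.

(** * Infinitely many pairs *)

Definition pair_with_order (N : nat) (m D : int) : Prop :=
  [/\ real_quadratic D, real_quadratic (D + m),
      class_number_divisible_by (Qsqrt D) N /\
      class_group_has_element_of_order (Qsqrt D) N
    & class_number_divisible_by (Qsqrt (D + m)) N /\
      class_group_has_element_of_order (Qsqrt (D + m)) N].

Lemma pair_with_order_exists (N m : nat) : (1 < N)%N -> (0 < m)%N ->
  exists D, pair_with_order N m%:Z D.
Proof.
move=> N1 m0; have [D [c1 c2]] := certificates_exist (ltnW N1) m0.
case: c1 => [x [y [z [A [B [k c1]]]]]]; case: c2 => [x' [y' [z' [A' [B' [k' c2]]]]]].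
exists D; split; [exact: cert_real c1|exact: cert_real c2| |].
  exact: certificate_class_group c1 N1.
exact: certificate_class_group c2 N1.
Qed.

Lemma pair_with_order_dvd (N d : nat) (m D : int) : (d %| N)%N ->
  pair_with_order N m D -> pair_with_order d m D.
Proof.
move=> dN [rq1 rq2 [[h1 h1P Nh1] o1] [[h2 h2P Nh2] o2]]; split=> //; split.
- by exists h1 => //; exact: dvdn_trans Nh1.
- exact: element_of_order_dvd dN o1.
- by exists h2 => //; exact: dvdn_trans Nh2.
exact: element_of_order_dvd dN o2.
Qed.

Lemma class_number_unique K h h' :
  class_number_is K h -> class_number_is K h' -> h = h'.
Proof.
by move=> hP h'P; apply/card_eq_II; exact: card_eq_trans (card_esym hP) h'P.
Qed.

Lemma class_number_gt0 D h : real_quadratic D -> class_number_is (Qsqrt D) h -> (0 < h)%N.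
Proof.
move=> rqD; case: h => // h0; have /seteqP[sub _] : class_group (Qsqrt D) = set0.
  by apply/eqP; rewrite -(@card_eq0 _ nat); move: h0; rewrite /class_number_is II0.
case: (sub (class_one (Qsqrt D))).
by exists (ring_of_integers (Qsqrt D)) => //; exact: fid_OK.
Qed.

Lemma finite_nat_bounded (A : set nat) : finite_set A ->
  exists H, forall a, A a -> (a <= H)%N.
Proof.
move=> /finite_seqP[s ->]; exists (\max_(i <- s) i)%N => a /= a_s.
exact: leq_bigmax_seq.
Qed.

Theorem theorem1p2 (N : nat) (m : int) (hN : (2 <= N)%N) (hm : 1 <= m) :
  exists2 S : set (set algC * set algC), infinite_set S &
    forall F1 F2 : set algC, S (F1, F2) ->
      [/\ exists D : int,
            [/\ 0 < D, ~ perfect_square D, ~ perfect_square (D + m),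
                F1 = Qsqrt D & F2 = Qsqrt (D + m)],
          class_number_divisible_by F1 N /\ class_number_divisible_by F2 N,
          forall e n : nat, N = (2 ^ e * n)%N -> odd n -> (1 < n)%N ->
            class_group_has_element_of_order F1 n /\
            class_group_has_element_of_order F2 n
        & odd N ->
            class_group_has_element_of_order F1 N /\
            class_group_has_element_of_order F2 N].
Proof.
case: m hm => [m m1|//]; have {m1} m0 : (0 < m)%N by [].
exists [set (Qsqrt D, Qsqrt (D + m%:Z)) | D in pair_with_order N m%:Z]; last first.
  move=> _ _ [D DP [<- <-]]; have [rq1 rq2 [d1 o1] [d2 o2]] := DP; split=> //.
    by exists D; split=> //; [exact: radicand_gt0|exact: radicand_nonsquare|
                             exact: radicand_nonsquare].
  move=> e n NE _ _.
  have [|_ _ [_ ?] [_ ?]] := @pair_with_order_dvd N n m%:Z D _ DP; last by split.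
  by rewrite NE dvdn_mull.
(* If the set were finite, some H would bound the class numbers of the first
   fields; a pair for N * H.+1 belongs to the set and exceeds this bound. *)
pose c (F : set algC * set algC) := xget 0%N (class_number_is F.1).
move=> /(finite_image c)/finite_nat_bounded[H HP].
have [|D DP] := @pair_with_order_exists (N * H.+1) m _ m0.
  by rewrite (leq_trans hN) // leq_pmulr.
have [rq1 _ [[h hP hdvd] _] _] := DP.
have hH : (h <= H)%N.
  have cE : c (Qsqrt D, Qsqrt (D + m%:Z)) = h.
    exact: class_number_unique (xgetPex 0%N (ex_intro _ h hP)) hP.
  rewrite -cE; apply: HP; exists (Qsqrt D, Qsqrt (D + m%:Z)) => //.
  by exists D => //; apply: pair_with_order_dvd DP; rewrite dvdn_mulr.
have := dvdn_leq (class_number_gt0 rq1 hP) hdvd; apply/negP.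
by rewrite -ltnNge (leq_ltn_trans hH) // (leq_pmull H.+1) // ltnW.
Qed.
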